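(* Let $T$ and $S$ be session types. If $T$ is a fair asynchronous subtype of $S$, written $T \leq S$, then $T$ refines $S$, written $T \sqsubseteq S$ (that is, every session type $S'$ that is compliant with $S$ is also compliant with $T$).
   Context: **Session types.** Fix a set $\mathcal L$ of labels. Session terms are generated by $T ::= \oplus\{l_i:T_i\}_{i\in I} \mid \&\{l_i:T_i\}_{i\in I} \mid \mu t.T \mid t \mid \mathbf{end}$, with $I$ a finite nonempty index set, $l_i\in\mathcal L$ pairwise distinct in each selection/branching ($\oplus$ is an output selection, $\&$ an input branching), $t$ a recursion variable bound by $\mu t$. Recursion is guarded: in $\mu t.T$, the variable $t$ occurs only within the scope of a selection or branching. A session type is a closed session term. $T\{T'/t\}$ denotes substitution of $T'$ for the free occurrences of $t$. Unfolding: $\mathsf{unfold}(\mu t.T')=\mathsf{unfold}(T'\{\mu t.T'/t\})$, and $\mathsf{unfold}(T)=T$ otherwise. **Semantics.** Configurations are $[T_1,\omega_1]\,|\,[T_2,\omega_2]$ with $T_1,T_2$ session types and $\omega_1,\omega_2\in\mathcal L^*$ (FIFO queues of incoming messages; $\epsilon$ is the empty word). The relation $\to$ is the least one closed under the following rules and their symmetric versions (swapping the two sides): (1) $[\oplus\{l_i:T_i\}_{i\in I},\omega_1]|[T_2,\omega_2]\to[T_j,\omega_1]|[T_2,\omega_2\cdot l_j]$ for $j\in I$; (2) $[\&\{l_i:T_i\}_{i\in I},l_j\cdot\omega_1]|[T_2,\omega_2]\to[T_j,\omega_1]|[T_2,\omega_2]$ for $j\in I$; (3) if $[\mathsf{unfold}(T_1),\omega_1]|[T_2,\omega_2]\to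 s$ then $[T_1,\omega_1]|[T_2,\omega_2]\to s$. $\to^*$ is the reflexive transitive closure. $[T,\omega_T]|[S,\omega_S]$ is successful iff $\mathsf{unfold}(T)=\mathsf{unfold}(S)=\mathbf{end}$ and $\omega_T=\omega_S=\epsilon$. A configuration $s$ is a correct composition if whenever $s\to^* s'$ there is $s''$ with $s'\to^* s''$ and $s''$ successful. $T$ and $S$ are compliant if $[T,\epsilon]|[S,\epsilon]$ is a correct composition. $T$ is controllable if there is a session type compliant with $T$. **Selective unfolding.** $\oplus g(t,T)$ holds if $t$ occurs free in $T$ only inside subterms of the form $\oplus\{l_i:T_i\}_{i\in I}$. $\mathsf{selUnfold}(T)$ is defined by: $\mathsf{selUnfold}(\oplus\{l_i:T_i\}_{i\in I})=\oplus\{l_i:T_i\}_{i\in I}$; $\mathsf{selUnfold}(\&\{l_i:T_i\}_{i\in I})=\&\{l_i:\mathsf{selUnfold}(T_i)\}_{i\in I}$; $\mathsf{selUnfold}(\mu t.T')=T'\{\mu t.T'/t\}$ if $\oplus g(t,T')$; $\mathsf{selUnfold}(\mu t.T')=\mu t.\mathsf{selUnfold}(\mathsf{selRepl}(t,\hat t,T')\{\mu t.T'/\hat t\})$ with $\hat t$ fresh if $\neg\oplus g(t,T')$, where $\mathsf{selRepl}(t,\hat t,T')$ is $T'$ with the free occurrences of $t$ lying inside an output-selection subterm of $T'$ replaced by $\hat t$; $\mathsf{selUnfold}(t)=t$; $\mathsf{selUnfold}(\mathbf{end})=\mathbf{end}$. **Input contexts.** $\mathcal A ::= [\,]^k \mid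 \&\{l_i:\mathcal A_i\}_{i\in I}\mid \mu t.\mathcal A\mid t$, with holes $[\,]^k$ ($k\in K$) pairwise distinct and recursion guarded (by an input branching). $\mathcal A[T_k]^{k\in K}$ is obtained by filling each hole $k$ with the session type $T_k$. **Fair asynchronous subtyping.** A relation $\mathcal R$ on session types is a controllable subtyping relation if $(T,S)\in\mathcal R$ implies: (1) if $T=\mathbf{end}$ then $\mathsf{unfold}(S)=\mathbf{end}$; (2) if $T=\mu t.T'$ then $(T'\{T/t\},S)\in\mathcal R$; (3) if $T=\&\{l_i:T_i\}_{i\in I}$ then $\mathsf{unfold}(S)=\&\{l_j:S_j\}_{j\in J}$, $I\supseteq K$ and $(T_k,S_k)\in\mathcal R$ for all $k\in K$, where $K=\{k\in J\mid S_k\text{ is controllable}\}$; (4) if $T=\oplus\{l_i:T_i\}_{i\in I}$ then $\mathsf{selUnfold}(S)=\mathcal A[\oplus\{l_i:S_{ki}\}_{i\in I}]^{k\in K}$ for some input context $\mathcal A$, and $(T_i,\mathcal A[S_{ki}]^{k\in K})\in\mathcal R$ for all $i\in I$. $T$ is a controllable subtype of $S$ if $(T,S)$ belongs to some controllable subtyping relation. $T\leq S$ holds iff: $S$ controllable implies $T$ is a controllable subtype of $S$. *)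

(* Defs.v *)
From Stdlib Require Import List Arith Lia Bool Relations.
Import ListNotations.

Set Implicit Arguments.
Unset Strict Implicit.

(** * Session terms

    Recursion variables are de Bruijn indices, so syntactic equality of terms is
    equality up to renaming of bound variables.  A family [{l_i : T_i}_{i in I}]
    is a list of label/continuation pairs; nothing below depends on its order. *)

Inductive term (L : Type) : Type :=
| Sel (bs : list (L * term L))
| Bra (bs : list (L * term L))
| Mu (T : term L)
| Var (n : nat)
| End.

Arguments Var {L} n.
Arguments End {L}.

Definition on_snd {L A B : Type} (f : A -> B) (p : L * A) : L * B :=
  match p with (l, x) => (l, f x) end.

Definition labels {L A : Type} (bs : list (L * A)) : list L := map fst bs.

Fixpoint free {L : Type} (n : nat) (T : term L) : bool :=
  match T with
  | Sel bs | Bra bs => existsb (fun p => match p with (_, U) => free n U end) bs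
  | Mu U => free (S n) U
  | Var m => n =? m
  | End => false
  end.

Definition closed {L : Type} (T : term L) : Prop := forall n, free n T = false.

(** [n] occurs free only within the scope of a selection or branching. *)
Fixpoint guarded {L : Type} (n : nat) (T : term L) : bool :=
  match T with
  | Sel _ | Bra _ | End => true
  | Mu U => guarded (S n) U
  | Var m => negb (n =? m)
  end.

(** [n] occurs free only within the scope of a selection: the predicate (+)g. *)
Fixpoint selGuarded {L : Type} (n : nat) (T : term L) : bool :=
  match T with
  | Sel _ | End => true
  | Bra bs => forallb (fun p => match p with (_, U) => selGuarded n U end) bs
  | Mu U => selGuarded (S n) U
  | Var m => negb (n =? m)
  end.

Inductive wf_term {L : Type} : term L -> Prop :=
| wf_Sel bs : bs <> [] -> NoDup (labels bs) ->
    (forall l T, In (l, T) bs -> wf_term T) -> wf_term (Sel bs)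
| wf_Bra bs : bs <> [] -> NoDup (labels bs) ->
    (forall l T, In (l, T) bs -> wf_term T) -> wf_term (Bra bs)
| wf_Mu T : guarded 0 T = true -> wf_term T -> wf_term (Mu T)
| wf_Var n : wf_term (Var n)
| wf_End : wf_term End.

Definition session {L : Type} (T : term L) : Prop := wf_term T /\ closed T.

(** * Substitution *)

Definition up_ren (r : nat -> nat) (n : nat) : nat :=
  match n with 0 => 0 | S m => S (r m) end.

Fixpoint rename {L : Type} (r : nat -> nat) (T : term L) : term L :=
  match T with
  | Sel bs => Sel (map (on_snd (rename r)) bs)
  | Bra bs => Bra (map (on_snd (rename r)) bs)
  | Mu U => Mu (rename (up_ren r) U)
  | Var n => Var (r n)
  | End => End
  end.

Definition up {L : Type} (s : nat -> term L) (n : nat) : term L :=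
  match n with 0 => Var 0 | S m => rename S (s m) end.

Fixpoint subst {L : Type} (s : nat -> term L) (T : term L) : term L :=
  match T with
  | Sel bs => Sel (map (on_snd (subst s)) bs)
  | Bra bs => Bra (map (on_snd (subst s)) bs)
  | Mu U => Mu (subst (up s) U)
  | Var n => s n
  | End => End
  end.

(** Instantiation of the outermost index: for [Mu T], [inst (Mu T) T] is
    [T{mu t.T / t}]. *)
Definition inst {L : Type} (U T : term L) : term L :=
  subst (fun n => match n with 0 => U | S m => Var m end) T.

(** Replacement of the free variable [x], all other indices being kept. *)
Definition subst_var {L : Type} (x : nat) (U T : term L) : term L :=
  subst (fun n => if n =? x then U else Var n) T.

(** * Unfolding *)

Fixpoint lead_mu {L : Type} (T : term L) : nat :=
  match T with Mu U => S (lead_mu U) | _ => 0 end.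

Fixpoint unfold_fuel {L : Type} (k : nat) (T : term L) : term L :=
  match k, T with
  | S k', Mu U => unfold_fuel k' (inst (Mu U) U)
  | _, _ => T
  end.

(** By guardedness each step removes one leading binder, so [lead_mu T] steps are
    enough: see [unfold_Mu]. *)
Definition unfold {L : Type} (T : term L) : term L := unfold_fuel (lead_mu T) T.

(** * Asynchronous semantics *)

Definition config (L : Type) : Type :=
  ((term L * list L) * (term L * list L))%type.

Inductive step {L : Type} : config L -> config L -> Prop :=
| step_out_l bs l T w1 T2 w2 : In (l, T) bs ->
    step ((Sel bs, w1), (T2, w2)) ((T, w1), (T2, w2 ++ [l]))
| step_in_l bs l T w1 T2 w2 : In (l, T) bs ->
    step ((Bra bs, l :: w1), (T2, w2)) ((T, w1), (T2, w2))
| step_unfold_l T1 w1 T2 w2 s :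
    step ((unfold T1, w1), (T2, w2)) s -> step ((T1, w1), (T2, w2)) s
| step_out_r bs l T w1 T1 w2 : In (l, T) bs ->
    step ((T1, w1), (Sel bs, w2)) ((T1, w1 ++ [l]), (T, w2))
| step_in_r bs l T w1 T1 w2 : In (l, T) bs ->
    step ((T1, w1), (Bra bs, l :: w2)) ((T1, w1), (T, w2))
| step_unfold_r T1 w1 T2 w2 s :
    step ((T1, w1), (unfold T2, w2)) s -> step ((T1, w1), (T2, w2)) s.

Definition steps {L : Type} : config L -> config L -> Prop :=
  clos_refl_trans (config L) step.

Definition successful {L : Type} (c : config L) : Prop :=
  match c with
  | ((T1, w1), (T2, w2)) => unfold T1 = End /\ unfold T2 = End /\ w1 = [] /\ w2 = []
  end.

Definition correct_composition {L : Type} (c : config L) : Prop :=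
  forall c', steps c c' -> exists c'', steps c' c'' /\ successful c''.

Definition compliant {L : Type} (T S : term L) : Prop :=
  correct_composition ((T, []), (S, [])).

Definition controllable {L : Type} (T : term L) : Prop :=
  exists S, session S /\ compliant S T.

Definition refines {L : Type} (T S : term L) : Prop :=
  forall S', session S' -> compliant S' S -> compliant S' T.

(** * Selective unfolding *)

(** Replaces by [h] the free occurrences of [t] lying inside a selection. *)
Fixpoint selRepl {L : Type} (t h : nat) (T : term L) : term L :=
  match T with
  | Sel bs => rename (fun n => if n =? t then h else n) (Sel bs)
  | Bra bs => Bra (map (on_snd (selRepl t h)) bs)
  | Mu U => Mu (selRepl (S t) (S h) U)
  | Var n => Var n
  | End => End
  end.

Fixpoint fv_bound {L : Type} (T : term L) : nat :=
  match T with
  | Sel bs | Bra bs =>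
      list_max (map (fun p => match p with (_, U) => fv_bound U end) bs)
  | Mu U => pred (fv_bound U)
  | Var n => S n
  | End => 0
  end.

Definition fresh {L : Type} (T : term L) : nat := S (fv_bound T).

Fixpoint selUnfold_fuel {L : Type} (k : nat) (T : term L) : term L :=
  match k with
  | 0 => T
  | S k' =>
      match T with
      | Sel bs => Sel bs
      | Bra bs => Bra (map (on_snd (selUnfold_fuel k')) bs)
      | Mu U =>
          if selGuarded 0 U then inst (Mu U) U
          else Mu (selUnfold_fuel k'
                     (subst_var (fresh U) (rename S (Mu U))
                                (selRepl 0 (fresh U) U)))
      | Var n => Var n
      | End => End
      end
  end.

(** Nesting depth outside selections.  Selective unfolding does not recurse into
    selections, and the substitution it performs only affects their contents. *)
Fixpoint outer_depth {L : Type} (T : term L) : nat :=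
  match T with
  | Sel _ | Var _ | End => 1
  | Bra bs =>
      S (list_max (map (fun p => match p with (_, U) => outer_depth U end) bs))
  | Mu U => S (outer_depth U)
  end.

(** Satisfies the recursive equations [selUnfold_Sel] ... [selUnfold_End] below. *)
Definition selUnfold {L : Type} (T : term L) : term L :=
  selUnfold_fuel (outer_depth T) T.

(** * Input contexts *)

Inductive ictx (L : Type) : Type :=
| CHole (k : nat)
| CBra (bs : list (L * ictx L))
| CMu (A : ictx L)
| CVar (n : nat).

Arguments CHole {L} k.
Arguments CVar {L} n.

Fixpoint cguarded {L : Type} (n : nat) (A : ictx L) : bool :=
  match A with
  | CHole _ | CBra _ => true
  | CMu A' => cguarded (S n) A'
  | CVar m => negb (n =? m)
  end.

Inductive wf_ictx {L : Type} : ictx L -> Prop :=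
| wf_CHole k : wf_ictx (CHole k)
| wf_CBra bs : bs <> [] -> NoDup (labels bs) ->
    (forall l A, In (l, A) bs -> wf_ictx A) -> wf_ictx (CBra bs)
| wf_CMu A : cguarded 0 A = true -> wf_ictx A -> wf_ictx (CMu A)
| wf_CVar n : wf_ictx (CVar n).

Fixpoint holes {L : Type} (A : ictx L) : list nat :=
  match A with
  | CHole k => [k]
  | CBra bs => flat_map (fun p => match p with (_, A') => holes A' end) bs
  | CMu A' => holes A'
  | CVar _ => []
  end.

Definition input_context {L : Type} (A : ictx L) : Prop :=
  wf_ictx A /\ NoDup (holes A).

(** Holes are only ever filled with closed terms, hence no index is shifted when
    a binder of the context is crossed. *)
Fixpoint fill {L : Type} (A : ictx L) (f : nat -> term L) : term L :=
  match A with
  | CHole k => f k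
  | CBra bs => Bra (map (on_snd (fun A' => fill A' f)) bs)
  | CMu A' => Mu (fill A' f)
  | CVar n => Var n
  end.

(** * Fair asynchronous subtyping *)

(** In the last clause [B k] lists, in some order, the family
    [{l_i : S_ki}_{i in I}] filling hole [k], where [I] is given by the labels of
    [bs] and [S_ki] is [Sf k l_i]. *)
Definition controllable_subtyping_relation {L : Type}
    (R : term L -> term L -> Prop) : Prop :=
  forall T S, R T S ->
    session T /\ session S /\
    (T = End -> unfold S = End) /\
    (forall T', T = Mu T' -> R (inst T T') S) /\
    (forall bs, T = Bra bs ->
       exists cs, unfold S = Bra cs /\
         forall l S', In (l, S') cs -> controllable S' ->
           exists T', In (l, T') bs /\ R T' S') /\
    (forall bs, T = Sel bs ->
       exists (A : ictx L) (B : nat -> list (L * term L))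
              (Sf : nat -> L -> term L),
         input_context A /\
         (forall k, In k (holes A) ->
            session (Sel (B k)) /\
            forall l U, In (l, U) (B k) <-> In l (labels bs) /\ U = Sf k l) /\
         selUnfold S = fill A (fun k => Sel (B k)) /\
         forall l T', In (l, T') bs -> R T' (fill A (fun k => Sf k l))).

Definition controllable_subtype {L : Type} (T S : term L) : Prop :=
  exists R, controllable_subtyping_relation R /\ R T S.

Definition fair_async_subtype {L : Type} (T S : term L) : Prop :=
  controllable S -> controllable_subtype T S.

(** * Recursive equations of [unfold] and [selUnfold] *)

Section Equations.
Context {L : Type}.
Implicit Types T U : term L.

Fixpoint term_nested_ind (P : term L -> Prop)
    (HSel : forall bs, (forall l T, In (l, T) bs -> P T) -> P (Sel bs))
    (HBra : forall bs, (forall l T, In (l, T) bs -> P T) -> P (Bra bs))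
    (HMu : forall T, P T -> P (Mu T))
    (HVar : forall n, P (Var n)) (HEnd : P End) (T : term L) {struct T} : P T :=
  let list_ind :=
    fix list_ind (bs : list (L * term L)) :
        forall l T, In (l, T) bs -> P T :=
      match bs return forall l T, In (l, T) bs -> P T with
      | [] => fun l T H => False_ind _ H
      | (l0, T0) :: bs' => fun l T H =>
          match H with
          | or_introl e =>
              eq_ind T0 P (term_nested_ind HSel HBra HMu HVar HEnd T0) T
                     (f_equal snd e)
          | or_intror H' => list_ind bs' l T H'
          end
      end in
  match T with
  | Sel bs => HSel bs (list_ind bs)
  | Bra bs => HBra bs (list_ind bs)
  | Mu U => HMu U (term_nested_ind HSel HBra HMu HVar HEnd U)
  | Var n => HVar n
  | End => HEnd
  end.

Lemma lead_mu_subst T (s : nat -> term L) :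
  (forall n, guarded n T = false -> exists m, s n = Var m) ->
  lead_mu (subst s T) = lead_mu T.
Proof.
  revert s; induction T as [bs|bs|T IH|n|]; intros s H; simpl; auto.
  - f_equal; apply IH; intros [|n] Hn; simpl.
    + now exists 0.
    + destruct (H n Hn) as [m ->]; simpl; eauto.
  - destruct (H n) as [m ->]; simpl; auto.
    now rewrite Nat.eqb_refl.
Qed.

Lemma unfold_Mu T : guarded 0 T = true -> unfold (Mu T) = unfold (inst (Mu T) T).
Proof.
  intros H; unfold unfold at 1; simpl; unfold unfold; f_equal.
  symmetry; apply lead_mu_subst; intros [|n] Hn; [congruence|eauto].
Qed.

Lemma unfold_not_Mu T : lead_mu T = 0 -> unfold T = T.
Proof. now unfold unfold; intros ->. Qed.

Lemma free_lt_fv_bound T n : free n T = true -> n < fv_bound T.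
Proof.
  revert n; induction T as [bs IH|bs IH|T IH|m|] using term_nested_ind;
    simpl; intros n H; try discriminate.
  1, 2: apply existsb_exists in H as [[l U] [Hin HU]];
    apply Nat.lt_le_trans with (1 := IH l U Hin n HU);
    assert (HF := proj1 (list_max_le
      (map (fun p => match p with (_, U) => fv_bound U end) bs) _) (le_n _));
    rewrite Forall_forall in HF; apply HF; apply in_map_iff; now exists (l, U).
  - apply IH in H; lia.
  - apply Nat.eqb_eq in H; lia.
Qed.

Lemma free_fresh T : free (fresh T) T = false.
Proof.
  destruct (free (fresh T) T) eqn:E; auto.
  apply free_lt_fv_bound in E; unfold fresh in E; lia.
Qed.

Lemma selGuarded_selRepl T t h :
  free h T = false -> selGuarded h (selRepl t h T) = true.
Proof.
  revert t h; induction T as [bs IH|bs IH|T IH|m|] using term_nested_ind;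
    simpl; intros t h H; auto.
  - apply forallb_forall; intros [l U] Hin.
    apply in_map_iff in Hin as [[l' V] [E Hin]]; inversion E; subst.
    apply (IH l V Hin); destruct (free h V) eqn:EV; auto.
    rewrite <- H; symmetry; apply existsb_exists; now exists (l, V).
  - now rewrite H.
Qed.

Lemma outer_depth_subst T (s : nat -> term L) :
  (forall n, selGuarded n T = false -> exists m, s n = Var m) ->
  outer_depth (subst s T) = outer_depth T.
Proof.
  revert s; induction T as [bs IH|bs IH|T IH|n|] using term_nested_ind;
    intros s H; simpl; auto.
  - f_equal; f_equal; rewrite map_map; apply map_ext_in; intros [l U] Hin; simpl.
    apply (IH l U Hin); intros n Hn; apply H; simpl.
    apply not_true_iff_false; intros HF; rewrite forallb_forall in HF.
    specialize (HF _ Hin); simpl in HF; congruence.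
  - f_equal; apply IH; intros [|n] Hn; simpl.
    + now exists 0.
    + destruct (H n Hn) as [m ->]; simpl; eauto.
  - destruct (H n) as [m ->]; simpl; auto.
    now rewrite Nat.eqb_refl.
Qed.

Lemma outer_depth_selRepl T t h : outer_depth (selRepl t h T) = outer_depth T.
Proof.
  revert t h; induction T as [bs IH|bs IH|T IH|n|] using term_nested_ind;
    intros t h; simpl; auto.
  f_equal; f_equal; rewrite map_map; apply map_ext_in; intros [l U] Hin; simpl.
  now apply (IH l U Hin).
Qed.

Lemma outer_depth_selective T V :
  outer_depth (subst_var (fresh T) V (selRepl 0 (fresh T) T)) = outer_depth T.
Proof.
  rewrite <- (outer_depth_selRepl T 0 (fresh T)).
  apply outer_depth_subst; intros n Hn.
  destruct (Nat.eqb_spec n (fresh T)) as [->|]; [|eauto].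
  rewrite selGuarded_selRepl in Hn; [discriminate|apply free_fresh].
Qed.

Lemma outer_depth_in (bs : list (L * term L)) l U : In (l, U) bs ->
  outer_depth U <=
  list_max (map (fun p => match p with (_, U) => outer_depth U end) bs).
Proof.
  intros Hin.
  assert (HF := proj1 (list_max_le
    (map (fun p => match p with (_, U) => outer_depth U end) bs) _) (le_n _)).
  rewrite Forall_forall in HF; apply HF; apply in_map_iff; now exists (l, U).
Qed.

Lemma selUnfold_fuel_enough k k' T :
  outer_depth T <= k -> outer_depth T <= k' ->
  selUnfold_fuel k T = selUnfold_fuel k' T.
Proof.
  revert k' T; induction k as [|k IH]; intros [|k'] T H H';
    try (destruct T; simpl in *; lia).
  destruct T as [bs|bs|T|n|]; simpl in *; auto.
  - f_equal; apply map_ext_in; intros [l U] Hin; simpl; f_equal.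
    apply outer_depth_in in Hin; apply IH; lia.
  - destruct (selGuarded 0 T); auto; f_equal; apply IH;
      rewrite outer_depth_selective; lia.
Qed.

Lemma selUnfold_Sel bs : selUnfold (L := L) (Sel bs) = Sel bs.
Proof. reflexivity. Qed.

Lemma selUnfold_Bra bs :
  selUnfold (L := L) (Bra bs) = Bra (map (on_snd selUnfold) bs).
Proof.
  unfold selUnfold at 1; simpl; f_equal; apply map_ext_in; intros [l U] Hin; simpl.
  f_equal; apply outer_depth_in in Hin; now apply selUnfold_fuel_enough.
Qed.

Lemma selUnfold_Mu T :
  selUnfold (Mu T) =
    if selGuarded 0 T then inst (Mu T) T
    else Mu (selUnfold (subst_var (fresh T) (rename S (Mu T))
                                  (selRepl 0 (fresh T) T))).
Proof.
  unfold selUnfold; simpl; destruct (selGuarded 0 T); auto.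
  now rewrite outer_depth_selective.
Qed.

Lemma selUnfold_Var n : selUnfold (L := L) (Var n) = Var n.
Proof. reflexivity. Qed.

Lemma selUnfold_End : selUnfold (L := L) End = End.
Proof. reflexivity. Qed.

End Equations.

(* Main.v *)
Require Import Defs.
From Stdlib Require Import List Arith Lia Relations.
Import ListNotations.

(** Fix [S'] compliant with [S].  Along a subtyping relation one keeps a pair [(T, S)]
    such that the configuration with [S] in place of [T] is a correct composition.  An
    output of [T] is matched by anticipating, in [S], the output that lies behind an
    input context: the partner cannot distinguish this, since the messages already
    queued come first and, if it waits for the anticipated one, the input context
    must be able to reach a hole by itself.  For fairness, one follows a path of the
    [S] configuration to success: at a selection, [T] chooses the label that this path
    sends from the hole, so that the path gets shorter. *)

(** Three obstacles shape the proof. The output clause speaks of [selUnfold S], which need not be an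
    unfolding of [S] and only has the same infinite tree. So paths and correctness are shown
    invariant under tree equality, which itself comes from the uniqueness of solutions of guarded
    equations. The input clause covers only controllable continuations, so the continuation of [S]
    after a message read by [T] must be shown controllable although the queues are not empty at that
    moment: the current partner is turned into one that starts from empty queues. Finally, unfolding
    a recursive input context copies its holes and leaves the grammar of contexts with distinct
    holes. Contexts are therefore replaced by the relation [antic], which unfolds on both sides at
    once and pairs a term with a whole family indexed by labels, since the label to anticipate is
    chosen only later. Safety and fairness are kept apart: correctness is proved by exhibiting an
    invariant, and each of its members reaches success by induction on the length of a path. *)

(** * Substitution, guardedness and unfolding *)

Section Substitution.
Context {L : Type}.
Implicit Types (T U V : term L) (s : nat -> term L).

Lemma map_on_snd_ext {A B : Type} (f g : A -> B) (bs : list (L * A)) :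
  (forall l x, In (l, x) bs -> f x = g x) ->
  map (on_snd f) bs = map (on_snd g) bs.
Proof.
  intros H; apply map_ext_in; intros [l x] Hin; simpl; f_equal; eauto.
Qed.

Lemma map_on_snd_map {A B C : Type} (f : A -> B) (g : B -> C) (bs : list (L * A)) :
  map (on_snd g) (map (on_snd f) bs) = map (on_snd (fun x => g (f x))) bs.
Proof. rewrite map_map; apply map_ext; now intros [l x]. Qed.

Lemma in_map_on_snd {A B : Type} (f : A -> B) (bs : list (L * A)) l y :
  In (l, y) (map (on_snd f) bs) <-> exists x, y = f x /\ In (l, x) bs.
Proof.
  rewrite in_map_iff; split.
  - intros [[l' x] [E Hin]]; inversion E; subst; eauto.
  - intros [x [-> Hin]]; now exists (l, x).
Qed.

Lemma labels_map_on_snd {A B : Type} (f : A -> B) (bs : list (L * A)) :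
  labels (map (on_snd f) bs) = labels bs.
Proof. unfold labels; rewrite map_map; apply map_ext; now intros [l x]. Qed.

Lemma free_branches_In n (bs : list (L * term L)) l U :
  In (l, U) bs -> free n U = true ->
  existsb (fun p => match p with (_, U) => free n U end) bs = true.
Proof. intros Hin HU; apply existsb_exists; now exists (l, U). Qed.

Lemma subst_ext_free T s s' :
  (forall n, free n T = true -> s n = s' n) -> subst s T = subst s' T.
Proof.
  revert s s'; induction T as [bs IH|bs IH|T IH|m|] using term_nested_ind;
    simpl; intros s s' H; auto.
  1, 2: f_equal; apply map_on_snd_ext; intros l U Hin; apply (IH l U Hin);
    intros n Hn; apply H; eapply free_branches_In; eauto.
  - f_equal; apply IH; intros [|n] Hn; simpl; auto; now rewrite H.
  - apply H, Nat.eqb_refl.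
Qed.

Lemma subst_ext T s s' : (forall n, s n = s' n) -> subst s T = subst s' T.
Proof. intros H; apply subst_ext_free; auto. Qed.

Lemma rename_as_subst T r : rename r T = subst (fun n => Var (r n)) T.
Proof.
  revert r; induction T as [bs IH|bs IH|T IH|m|] using term_nested_ind;
    simpl; intros r; auto.
  1, 2: f_equal; apply map_on_snd_ext; intros l U Hin; apply (IH l U Hin).
  f_equal; rewrite IH; apply subst_ext; now intros [|n].
Qed.

Lemma subst_rename T s r : subst s (rename r T) = subst (fun n => s (r n)) T.
Proof.
  revert s r; induction T as [bs IH|bs IH|T IH|m|] using term_nested_ind;
    simpl; intros s r; auto.
  1, 2: f_equal; rewrite map_on_snd_map; apply map_on_snd_ext;
    intros l U Hin; apply (IH l U Hin).
  f_equal; rewrite IH; apply subst_ext; now intros [|n].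
Qed.

Lemma rename_rename T r r' : rename r (rename r' T) = rename (fun n => r (r' n)) T.
Proof. now rewrite (rename_as_subst _ r), subst_rename, <- rename_as_subst. Qed.

Lemma rename_subst T s r : rename r (subst s T) = subst (fun n => rename r (s n)) T.
Proof.
  revert s r; induction T as [bs IH|bs IH|T IH|m|] using term_nested_ind;
    simpl; intros s r; auto.
  1, 2: f_equal; rewrite map_on_snd_map; apply map_on_snd_ext;
    intros l U Hin; apply (IH l U Hin).
  f_equal; rewrite IH; apply subst_ext; intros [|n]; simpl; auto.
  now rewrite !rename_rename.
Qed.

Lemma subst_subst T s t : subst t (subst s T) = subst (fun n => subst t (s n)) T.
Proof.
  revert s t; induction T as [bs IH|bs IH|T IH|m|] using term_nested_ind;
    simpl; intros s t; auto.
  1, 2: f_equal; rewrite map_on_snd_map; apply map_on_snd_ext;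
    intros l U Hin; apply (IH l U Hin).
  f_equal; rewrite IH; apply subst_ext; intros [|n]; simpl; auto.
  now rewrite subst_rename, rename_subst.
Qed.

Lemma subst_Var T : subst Var T = T.
Proof.
  induction T as [bs IH|bs IH|T IH|m|] using term_nested_ind; simpl; auto.
  1, 2: f_equal; rewrite <- (map_id bs) at 2; apply map_ext_in;
    intros [l U] Hin; simpl; f_equal; apply (IH l U Hin).
  f_equal; rewrite <- IH at 2; apply subst_ext; now intros [|n].
Qed.

Definition scons U s (n : nat) : term L :=
  match n with 0 => U | S m => s m end.

Lemma inst_subst_up U V s : inst V (subst (up s) U) = subst (scons V s) U.
Proof.
  unfold inst; rewrite subst_subst; apply subst_ext; intros [|n]; simpl; auto.
  rewrite subst_rename; apply subst_Var.
Qed.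

Lemma subst_closed T s : closed T -> subst s T = T.
Proof.
  intros H; rewrite <- subst_Var; apply subst_ext_free; intros n Hn.
  now rewrite (H n) in Hn.
Qed.

Lemma free_rename n T r :
  free n (rename r T) = true -> exists m, free m T = true /\ n = r m.
Proof.
  revert n r; induction T as [bs IH|bs IH|T IH|m|] using term_nested_ind;
    simpl; intros n r H; try discriminate.
  1, 2: apply existsb_exists in H as [[l U] [Hin HU]];
    apply in_map_on_snd in Hin as [U' [-> Hin]];
    destruct (IH l U' Hin _ _ HU) as [m [Hm ->]]; exists m; split; auto;
    eapply free_branches_In; eauto.
  - destruct (IH _ _ H) as [[|m] [Hm E]]; simpl in E; inversion E; eauto.
  - apply Nat.eqb_eq in H; exists m; split; auto; apply Nat.eqb_refl.
Qed.

Lemma free_subst n T s :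
  free n (subst s T) = true -> exists m, free m T = true /\ free n (s m) = true.
Proof.
  revert n s; induction T as [bs IH|bs IH|T IH|m|] using term_nested_ind;
    simpl; intros n s H; try discriminate.
  1, 2: apply existsb_exists in H as [[l U] [Hin HU]];
    apply in_map_on_snd in Hin as [U' [-> Hin]];
    destruct (IH l U' Hin _ _ HU) as [m [Hm Hs]]; exists m; split; auto;
    eapply free_branches_In; eauto.
  - destruct (IH _ _ H) as [[|m] [Hm E]]; simpl in E; [discriminate|].
    apply free_rename in E as [k [Hk E]]; inversion E; subst; eauto.
  - exists m; split; auto; apply Nat.eqb_refl.
Qed.

Lemma guarded_not_free n T : free n T = false -> guarded n T = true.
Proof.
  revert n; induction T as [bs|bs|T IH|m|]; simpl; intros n H; auto.
  now rewrite H.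
Qed.

Lemma guarded_rename n T r :
  (forall m, guarded m T = false -> r m <> n) -> guarded n (rename r T) = true.
Proof.
  revert n r; induction T as [bs|bs|T IH|m|]; simpl; intros n r H; auto.
  - apply IH; intros [|m] Hm; simpl; [lia|].
    specialize (H m Hm); lia.
  - specialize (H m); rewrite Nat.eqb_refl in H; simpl in H.
    apply Bool.negb_true_iff, Nat.eqb_neq; intros E; now apply H.
Qed.

Lemma guarded_subst n T s :
  (forall m, guarded m T = false -> guarded n (s m) = true) ->
  guarded n (subst s T) = true.
Proof.
  revert n s; induction T as [bs|bs|T IH|m|]; simpl; intros n s H; auto.
  - apply IH; intros [|m] Hm; simpl; auto.
    apply guarded_rename; intros k Hk E; injection E as ->.
    rewrite H in Hk; [discriminate|auto].
  - apply H; now rewrite Nat.eqb_refl.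
Qed.

Lemma guarded_up T s : guarded 0 T = true -> guarded 0 (subst (up s) T) = true.
Proof.
  intros H; apply guarded_subst; intros [|m] Hm; [congruence|].
  now apply guarded_rename.
Qed.

Lemma wf_rename T r : wf_term T -> wf_term (rename r T).
Proof.
  intros H; revert r; induction H; simpl; intros r.
  1, 2: constructor; [now destruct bs|now rewrite labels_map_on_snd|];
    intros l U Hin; apply in_map_on_snd in Hin as [U' [-> Hin]]; eauto.
  - constructor; auto; apply guarded_rename; intros [|m] Hm; simpl; congruence.
  - constructor.
  - constructor.
Qed.

Lemma wf_subst T s : wf_term T -> (forall n, wf_term (s n)) -> wf_term (subst s T).
Proof.
  intros H; revert s; induction H; simpl; intros s Hs; auto.
  1, 2: constructor; [now destruct bs|now rewrite labels_map_on_snd|];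
    intros l U Hin; apply in_map_on_snd in Hin as [U' [-> Hin]]; eauto.
  - constructor; [now apply guarded_up|].
    apply IHwf_term; intros [|n]; simpl; [constructor|]; now apply wf_rename.
  - constructor.
Qed.

Lemma wf_inst U : wf_term (Mu U) -> wf_term (inst (Mu U) U).
Proof.
  intros H; inversion H; subst; apply wf_subst; auto.
  intros [|n]; auto; constructor.
Qed.

(** Keeps the unfolding of a substituted recursion in the form of one substitution in its body, so
    that claims about all substitutions can be proved through that body. *)
Lemma unfold_Mu_subst U s :
  guarded 0 U = true ->
  unfold (subst s (Mu U)) = unfold (subst (scons (subst s (Mu U)) s) U).
Proof.
  intros H; simpl; rewrite unfold_Mu; [|now apply guarded_up].
  now rewrite inst_subst_up.
Qed.

Lemma lead_mu_inst U : guarded 0 U = true -> lead_mu (inst (Mu U) U) = lead_mu U.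
Proof.
  intros H; apply lead_mu_subst; intros [|n] Hn; [congruence|eauto].
Qed.

Lemma closed_inst U : closed (Mu U) -> closed (inst (Mu U) U).
Proof.
  intros H n; destruct (free n (inst (Mu U) U)) eqn:E; auto.
  apply free_subst in E as [[|m] [Hm E]]; [now rewrite (H n) in E|].
  specialize (H m); simpl in H; congruence.
Qed.

Lemma session_inst U : session (Mu U) -> session (inst (Mu U) U).
Proof. intros [H1 H2]; split; [now apply wf_inst|now apply closed_inst]. Qed.

(** Replaces reasoning about fuel: by guardedness, each unfolding step removes exactly one leading
    binder. *)
Lemma unfold_ind (P : term L -> term L -> Prop) T :
  wf_term T ->
  (forall T, lead_mu T = 0 -> P T T) ->
  (forall U T, wf_term (Mu U) -> P (inst (Mu U) U) T -> P (Mu U) T) ->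
  P T (unfold T).
Proof.
  intros HT H0 HS; remember (lead_mu T) as k eqn:E; revert T HT E.
  induction k as [|k IH]; intros T HT E.
  - rewrite unfold_not_Mu by auto; auto.
  - destruct T; simpl in E; try discriminate; inversion E; subst.
    inversion HT; subst.
    apply HS; auto; rewrite unfold_Mu by auto.
    apply IH; [now apply wf_inst|now rewrite lead_mu_inst].
Qed.

Lemma lead_mu_unfold T : wf_term T -> lead_mu (unfold T) = 0.
Proof. intros HT; pattern T, (unfold T); apply unfold_ind; auto. Qed.

Lemma unfold_unfold T : wf_term T -> unfold (unfold T) = unfold T.
Proof. intros HT; now apply unfold_not_Mu, lead_mu_unfold. Qed.

Lemma wf_unfold T : wf_term T -> wf_term (unfold T).
Proof.
  intros HT; generalize HT; pattern T at 1, (unfold T); apply unfold_ind; auto.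
  intros U V HU IH _; apply IH; now apply wf_inst.
Qed.

Lemma session_unfold T : session T -> session (unfold T).
Proof.
  intros HT; generalize HT; pattern T at 1, (unfold T); apply unfold_ind; auto.
  - apply HT.
  - intros U V _ IH HU; apply IH; now apply session_inst.
Qed.

Lemma wf_branch_Sel (bs : list (L * term L)) l T :
  wf_term (Sel bs) -> In (l, T) bs -> wf_term T.
Proof. intros H; inversion H; subst; eauto. Qed.

Lemma wf_branch_Bra (bs : list (L * term L)) l T :
  wf_term (Bra bs) -> In (l, T) bs -> wf_term T.
Proof. intros H; inversion H; subst; eauto. Qed.

Lemma NoDup_labels_eq {A : Type} (bs : list (L * A)) l x y :
  NoDup (labels bs) -> In (l, x) bs -> In (l, y) bs -> x = y.
Proof.
  induction bs as [|[l' z] bs IH]; simpl; [tauto|]; intros H.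
  inversion H as [|? ? Hn Hd]; subst.
  intros [E|Hx] [E'|Hy]; auto.
  - congruence.
  - inversion E; subst; destruct Hn; apply in_map_iff; now exists (l, y).
  - inversion E'; subst; destruct Hn; apply in_map_iff; now exists (l, x).
Qed.

Lemma Bra_branch_eq (bs : list (L * term L)) l x y :
  wf_term (Bra bs) -> In (l, x) bs -> In (l, y) bs -> x = y.
Proof. intros H; inversion H; subst; now apply NoDup_labels_eq. Qed.

Lemma session_branch (bs : list (L * term L)) l T :
  session (Sel bs) \/ session (Bra bs) -> In (l, T) bs -> session T.
Proof.
  intros H Hin; split.
  - destruct H as [[H _]|[H _]]; [eapply wf_branch_Sel|eapply wf_branch_Bra]; eauto.
  - intros n; destruct (free n T) eqn:E; auto.
    apply (free_branches_In _ _ _ _ Hin) in E.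
    destruct H as [[_ H]|[_ H]]; specialize (H n); simpl in H; congruence.
Qed.

End Substitution.

(** * Infinite trees, and their invariance under selective unfolding *)

Section Trees.
Context {L : Type}.
Implicit Types (T U V P Q : term L) (s t : nat -> term L).

Definition same_branch (R : term L -> term L -> Prop) (p q : L * term L) : Prop :=
  fst p = fst q /\ R (snd p) (snd q).

(* The infinite trees of [P] and [Q] agree up to depth [k]. *)
Fixpoint aeq (k : nat) P Q : Prop :=
  match k with
  | 0 => True
  | S k' =>
      match unfold P, unfold Q with
      | Sel bs, Sel cs | Bra bs, Bra cs => Forall2 (same_branch (aeq k')) bs cs
      | Mu _, Mu _ | End, End => True
      | Var n, Var m => n = m
      | _, _ => False
      end
  end.

(** Given by finite approximations instead of coinduction, so that proofs are inductions on the
    depth. *)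
Definition teq P Q : Prop := forall k, aeq k P Q.

Lemma Forall2_same {A : Type} (R : A -> A -> Prop) xs :
  (forall x, R x x) -> Forall2 R xs xs.
Proof. intros H; induction xs; auto. Qed.

Lemma Forall2_trans {A : Type} (R : A -> A -> Prop) xs ys zs :
  (forall x y z, R x y -> R y z -> R x z) ->
  Forall2 R xs ys -> Forall2 R ys zs -> Forall2 R xs zs.
Proof.
  intros H Hxy; revert zs; induction Hxy; intros zs Hyz; inversion Hyz; subst; eauto.
Qed.

Lemma Forall2_all {A : Type} (R : nat -> A -> A -> Prop) xs ys :
  (forall k, Forall2 (R k) xs ys) -> Forall2 (fun x y => forall k, R k x y) xs ys.
Proof.
  revert ys; induction xs as [|x xs IH]; intros ys H.
  - specialize (H 0); inversion H; constructor.
  - destruct ys as [|y ys]; [specialize (H 0); inversion H|].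
    constructor; [|apply IH]; intros k; specialize (H k); now inversion H.
Qed.

Lemma aeq_unfold k P Q P' Q' :
  unfold P = unfold P' -> unfold Q = unfold Q' -> aeq k P Q -> aeq k P' Q'.
Proof. destruct k; simpl; auto; now intros -> ->. Qed.

Lemma aeq_refl k P : aeq k P P.
Proof.
  revert P; induction k as [|k IH]; simpl; auto; intros P; destruct (unfold P); auto.
  all: apply Forall2_same; split; auto.
Qed.

Lemma aeq_sym k P Q : aeq k P Q -> aeq k Q P.
Proof.
  revert P Q; induction k as [|k IH]; simpl; auto; intros P Q.
  destruct (unfold P), (unfold Q); auto.
  all: intros H; apply Forall2_flip; eapply Forall2_impl; [|exact H];
    intros p q [E Hpq]; split; auto.
Qed.

Lemma aeq_trans k P Q V : aeq k P Q -> aeq k Q V -> aeq k P V.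
Proof.
  revert P Q V; induction k as [|k IH]; simpl; auto; intros P Q V.
  destruct (unfold P), (unfold Q), (unfold V); try tauto; try congruence.
  all: apply Forall2_trans; intros p q r [E H] [E' H']; split;
    [congruence|eauto].
Qed.

Lemma aeq_le k j P Q : j <= k -> aeq k P Q -> aeq j P Q.
Proof.
  revert j P Q; induction k as [|k IH]; intros [|j] P Q Hle; simpl; auto; [lia|].
  destruct (unfold P), (unfold Q); auto.
  all: apply Forall2_impl; intros p q [E H]; split; auto; apply IH; auto; lia.
Qed.

Lemma teq_refl P : teq P P.
Proof. intros k; apply aeq_refl. Qed.

Lemma teq_sym P Q : teq P Q -> teq Q P.
Proof. intros H k; now apply aeq_sym. Qed.

Lemma teq_trans P Q V : teq P Q -> teq Q V -> teq P V.
Proof. intros H H' k; eapply aeq_trans; eauto. Qed.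

Lemma teq_unfold_eq P Q : unfold P = unfold Q -> teq P Q.
Proof. intros H k; apply (aeq_unfold k P P); auto; apply aeq_refl. Qed.

(** Branches are paired by position, hence in the same way at every depth; [Forall2_all] can thus
    move the depth inside and yield full tree equality of the continuations. *)
Lemma teq_Sel P Q bs l P' :
  teq P Q -> unfold P = Sel bs -> In (l, P') bs ->
  exists cs Q', unfold Q = Sel cs /\ In (l, Q') cs /\ teq P' Q'.
Proof.
  intros H E Hin; assert (H1 := H 1); simpl in H1; rewrite E in H1.
  destruct (unfold Q) as [cs| | | |] eqn:EQ; try tauto.
  assert (HF : forall k, Forall2 (same_branch (aeq k)) bs cs).
  { intros k; specialize (H (S k)); simpl in H; now rewrite E, EQ in H. }
  apply Forall2_all in HF.
  destruct (in_split _ _ Hin) as [b1 [b2 ->]].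
  apply Forall2_app_inv_l in HF as [c1 [c2 [_ [HF ->]]]].
  inversion HF as [|? [l' Q'] ? c3 Hpq]; subst.
  destruct (Hpq 0) as [El _]; simpl in El; subst l'.
  exists (c1 ++ (l, Q') :: c3), Q'; repeat split; auto.
  - apply in_elt.
  - intros k; apply (Hpq k).
Qed.

Lemma teq_Bra P Q bs l P' :
  teq P Q -> unfold P = Bra bs -> In (l, P') bs ->
  exists cs Q', unfold Q = Bra cs /\ In (l, Q') cs /\ teq P' Q'.
Proof.
  intros H E Hin; assert (H1 := H 1); simpl in H1; rewrite E in H1.
  destruct (unfold Q) as [|cs| | |] eqn:EQ; try tauto.
  assert (HF : forall k, Forall2 (same_branch (aeq k)) bs cs).
  { intros k; specialize (H (S k)); simpl in H; now rewrite E, EQ in H. }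
  apply Forall2_all in HF.
  destruct (in_split _ _ Hin) as [b1 [b2 ->]].
  apply Forall2_app_inv_l in HF as [c1 [c2 [_ [HF ->]]]].
  inversion HF as [|? [l' Q'] ? c3 Hpq]; subst.
  destruct (Hpq 0) as [El _]; simpl in El; subst l'.
  exists (c1 ++ (l, Q') :: c3), Q'; repeat split; auto.
  - apply in_elt.
  - intros k; apply (Hpq k).
Qed.

Lemma teq_End P Q : teq P Q -> unfold P = End -> unfold Q = End.
Proof.
  intros H E; specialize (H 1); simpl in H; rewrite E in H; now destruct (unfold Q).
Qed.

Lemma Forall2_map_on_snd (R : term L -> term L -> Prop) (f g : term L -> term L)
    (bs : list (L * term L)) :
  (forall l U, In (l, U) bs -> R (f U) (g U)) ->
  Forall2 (same_branch R) (map (on_snd f) bs) (map (on_snd g) bs).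
Proof.
  induction bs as [|[l U] bs IH]; simpl; intros H; constructor.
  - split; simpl; eauto.
  - apply IH; eauto.
Qed.

(* A guarded variable is met at depth at least one, so one level of agreement
   less is enough for the terms replacing it. *)
Lemma aeq_subst T : wf_term T -> forall k s t,
  (forall n, guarded n T = false -> aeq k (s n) (t n)) ->
  (forall n, aeq (pred k) (s n) (t n)) ->
  aeq k (subst s T) (subst t T).
Proof.
  induction 1 as [bs _ _ _ IH|bs _ _ _ IH|T HG HT IH|n|]; intros k s t Hg Hp.
  - destruct k; simpl; auto; apply Forall2_map_on_snd; intros l U Hin.
    apply (IH l U Hin); auto; intros n; eapply aeq_le; [|apply Hp]; simpl; lia.
  - destruct k; simpl; auto; apply Forall2_map_on_snd; intros l U Hin.
    apply (IH l U Hin); auto; intros n; eapply aeq_le; [|apply Hp]; simpl; lia.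
  (* The recursion replaces its own variable, which is guarded, so the two instances of it have to
     agree only one level less deep. *)
  - induction k as [|k IHk]; [exact I|].
    apply (aeq_unfold (S k) (subst (scons (subst s (Mu T)) s) T)
                            (subst (scons (subst t (Mu T)) t) T));
      try (symmetry; now apply unfold_Mu_subst).
    apply IH.
    + intros [|n] Hn; [congruence|]; now apply Hg.
    + intros [|n]; simpl; [|apply Hp].
      apply IHk.
      * intros n Hn; eapply aeq_le; [|now apply Hg]; lia.
      * intros n; eapply aeq_le; [|apply Hp]; simpl; lia.
  - simpl; apply Hg; simpl; now rewrite Nat.eqb_refl.
  - apply aeq_refl.
Qed.

(** Selective unfolding works below binders, so open terms have to be compared as well. *)
Definition oeq P Q : Prop := forall s, teq (subst s P) (subst s Q).

(** After one unfolding, the recursive calls are exchanged by the induction hypothesis, at smaller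
    depth thanks to guardedness; then the bodies are exchanged under a common substitution. *)
Lemma oeq_Mu P Q :
  wf_term (Mu P) -> wf_term (Mu Q) -> oeq P Q -> oeq (Mu P) (Mu Q).
Proof.
  intros HP HQ H s k; inversion HP; inversion HQ; subst.
  induction k as [|k IH]; [exact I|].
  apply (aeq_unfold (S k) (subst (scons (subst s (Mu P)) s) P)
                          (subst (scons (subst s (Mu Q)) s) Q));
    try (symmetry; now apply unfold_Mu_subst).
  apply aeq_trans with (subst (scons (subst s (Mu Q)) s) P); [|apply H].
  apply aeq_subst; auto.
  - intros [|n] Hn; [congruence|apply aeq_refl].
  - intros [|n]; [exact IH|apply aeq_refl].
Qed.

Lemma guarded_selRepl m T i h : guarded m (selRepl i h T) = guarded m T.
Proof. revert m i h; induction T; simpl; auto. Qed.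

Lemma wf_selRepl T i h : wf_term T -> wf_term (selRepl i h T).
Proof.
  intros H; revert i h; induction H as [bs Hn Hd HT _|bs Hn Hd _ IH|T HG HT IH|n|];
    intros i h.
  - apply (wf_rename (Sel bs)); now constructor.
  - simpl; constructor; [now destruct bs|now rewrite labels_map_on_snd|].
    intros l U Hin; apply in_map_on_snd in Hin as [U' [-> Hin]]; eauto.
  - simpl; constructor; auto; now rewrite guarded_selRepl.
  - constructor.
  - constructor.
Qed.

(** Splitting a variable in two is undone once both copies receive the same value. *)
Lemma subst_selRepl T i h s : s i = s h -> subst s (selRepl i h T) = subst s T.
Proof.
  revert i h s; induction T as [bs IH|bs IH|T IH|n|] using term_nested_ind;
    intros i h s H; auto.
  - change (selRepl i h (Sel bs))
      with (rename (fun n => if n =? i then h else n) (Sel bs)).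
    rewrite subst_rename; apply subst_ext; intros n.
    now destruct (Nat.eqb_spec n i) as [->|].
  - simpl; f_equal; rewrite map_on_snd_map; apply map_on_snd_ext.
    intros l U Hin; now apply (IH l U Hin).
  - simpl; f_equal; apply IH; simpl; now rewrite H.
Qed.

Definition selBody U : term L :=
  subst_var (fresh U) (rename S (Mu U)) (selRepl 0 (fresh U) U).

Lemma guarded_selBody n U : guarded n U = true -> guarded n (selBody U) = true.
Proof.
  intros H; apply guarded_subst; intros m; rewrite guarded_selRepl; intros Hm.
  destruct (Nat.eqb_spec m (fresh U)) as [->|].
  - rewrite (guarded_not_free _ _ (free_fresh U)) in Hm; discriminate.
  - simpl; destruct (Nat.eqb_spec n m) as [->|]; auto; congruence.
Qed.

Lemma wf_selBody U : wf_term (Mu U) -> wf_term (selBody U).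
Proof.
  intros H; inversion H; subst; apply wf_subst; [now apply wf_selRepl|].
  intros n; destruct (n =? fresh U); [now apply wf_rename|constructor].
Qed.

(* Both sides solve the guarded equation [X = U{X}], whose solution is unique. *)
Lemma oeq_selBody U : wf_term (Mu U) -> oeq (Mu U) (Mu (selBody U)).
Proof.
  intros HU s k; assert (HW := wf_selBody U HU); inversion HU; subst.
  assert (HG := guarded_selBody 0 U ltac:(assumption)).
  induction k as [|k IH]; [exact I|].
  set (X := subst s (Mu U)) in *; set (Y := subst s (Mu (selBody U))) in *.
  (* The fresh variable always stands for the original recursion [X]. With [V = X] the selective
     replacement is undone, with [V = Y] the unfolding of [Y] results. *)
  pose (f := fun V n => if n =? fresh U then X else scons V s n).
  apply (aeq_unfold (S k) (subst (f X) (selRepl 0 (fresh U) U))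
                          (subst (f Y) (selRepl 0 (fresh U) U))).
  - rewrite subst_selRepl by (unfold f; now rewrite Nat.eqb_refl).
    unfold X; rewrite unfold_Mu_subst by auto; f_equal.
    apply subst_ext_free; intros n Hn; unfold f.
    destruct (Nat.eqb_spec n (fresh U)) as [->|]; auto.
    rewrite free_fresh in Hn; discriminate.
  - unfold Y; rewrite unfold_Mu_subst by auto; f_equal; fold Y.
    unfold selBody, subst_var; rewrite subst_subst; apply subst_ext; intros n.
    unfold f; destruct (n =? fresh U); auto.
    rewrite subst_rename; symmetry; apply subst_ext; now intros m.
  - apply aeq_subst; [now apply wf_selRepl| |].
    + intros n; rewrite guarded_selRepl; intros Hn; unfold f.
      destruct (n =? fresh U); [apply aeq_refl|].
      destruct n; [congruence|apply aeq_refl].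
    + intros n; unfold f; destruct (n =? fresh U); [apply aeq_refl|].
      destruct n; [exact IH|apply aeq_refl].
Qed.

Lemma outer_depth_selBody U : outer_depth (selBody U) = outer_depth U.
Proof. apply outer_depth_selective. Qed.

(** The induction is on the outer depth because [selBody U] is not a subterm of [Mu U], but has the
    outer depth of [U]. Guardedness is carried along to rebuild a well-formed recursion, to which
    [oeq_Mu] applies. *)
Lemma selUnfold_spec T : wf_term T ->
  wf_term (selUnfold T) /\
  (forall n, guarded n T = true -> guarded n (selUnfold T) = true) /\
  oeq T (selUnfold T).
Proof.
  remember (outer_depth T) as d eqn:Ed; revert T Ed.
  induction d as [d IH] using lt_wf_ind; intros T -> HT.
  destruct T as [bs|bs|U|n|].
  - repeat split; auto; intros s; apply teq_refl.
  - rewrite selUnfold_Bra.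
    assert (IHb : forall l U, In (l, U) bs ->
              wf_term (selUnfold U) /\ oeq U (selUnfold U)).
    { intros l U Hin; destruct (IH (outer_depth U)) with (T := U) as [? [? ?]]; auto.
      - simpl; apply outer_depth_in in Hin; lia.
      - eapply wf_branch_Bra; eauto. }
    inversion HT; subst; repeat split; auto.
    + constructor; [now destruct bs|now rewrite labels_map_on_snd|].
      intros l U Hin; apply in_map_on_snd in Hin as [U' [-> Hin]].
      now apply (IHb l U' Hin).
    + intros s [|k]; simpl; auto; rewrite map_on_snd_map.
      apply Forall2_map_on_snd; intros l U Hin; now apply (IHb l U Hin).
  - rewrite selUnfold_Mu; inversion HT; subst.
    destruct (selGuarded 0 U).
    + repeat split; [now apply wf_inst| |].
      * intros n Hn; apply guarded_subst; intros [|m] Hm; [congruence|].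
        simpl in *; destruct (Nat.eqb_spec n m) as [->|]; auto; congruence.
      * intros s; apply teq_unfold_eq; rewrite unfold_Mu_subst by auto; f_equal.
        unfold inst; rewrite subst_subst; apply subst_ext; now intros [|n].
    + fold (selBody U).
      destruct (IH (outer_depth (selBody U))) with (T := selBody U)
        as [H1' [H2' H3']]; auto.
      * rewrite outer_depth_selBody; simpl; lia.
      * now apply wf_selBody.
      * assert (HG := guarded_selBody 0 U ltac:(assumption)).
        assert (HM : wf_term (Mu (selUnfold (selBody U)))) by (constructor; auto).
        repeat split; auto.
        -- intros n Hn; apply H2', guarded_selBody, Hn.
        -- intros s; apply teq_trans with (subst s (Mu (selBody U))).
           ++ now apply oeq_selBody.
           ++ apply oeq_Mu; auto; constructor; auto; now apply wf_selBody.
  - repeat split; auto; intros s; apply teq_refl.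
  - repeat split; auto; intros s; apply teq_refl.
Qed.

Lemma wf_selUnfold T : wf_term T -> wf_term (selUnfold T).
Proof. apply selUnfold_spec. Qed.

Lemma teq_selUnfold T : wf_term T -> teq T (selUnfold T).
Proof.
  intros HT k; generalize (proj2 (proj2 (selUnfold_spec T HT)) Var k).
  now rewrite !subst_Var.
Qed.

End Trees.

(** * Moves modulo unfolding, and invariants for correctness *)

Section Semantics.
Context {L : Type}.
Implicit Types (X Y P T U : term L) (q w u : list L).

(** [act X q w X' q' w']: one participant of type [X] moves, [q] being its own queue
    and [w] that of its partner. *)
Inductive act : term L -> list L -> list L -> term L -> list L -> list L -> Prop :=
| act_out X bs l X' q w :
    unfold X = Sel bs -> In (l, X') bs -> act X q w X' q (w ++ [l])
| act_in X bs l X' q w :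
    unfold X = Bra bs -> In (l, X') bs -> act X (l :: q) w X' q w.

Lemma act_unfold_eq X Y q w X' q' w' :
  unfold X = unfold Y -> act X q w X' q' w' -> act Y q w X' q' w'.
Proof.
  intros E H; inversion H; subst; econstructor; eauto; congruence.
Qed.

Lemma act_session X q w X' q' w' : session X -> act X q w X' q' w' -> session X'.
Proof.
  intros HX H; apply session_unfold in HX.
  inversion H; subst; eapply session_branch; eauto;
    match goal with E : unfold _ = _ |- _ => rewrite <- E end; auto.
Qed.

Lemma act_wf X q w X' q' w' : wf_term X -> act X q w X' q' w' -> wf_term X'.
Proof.
  intros HX H; apply wf_unfold in HX.
  inversion H; subst; match goal with E : unfold _ = _ |- _ => rewrite E in HX end;
    [eapply wf_branch_Sel|eapply wf_branch_Bra]; eauto.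
Qed.

Inductive move : config L -> config L -> Prop :=
| move_l X q Y w X' q' w' :
    act X q w X' q' w' -> move ((X, q), (Y, w)) ((X', q'), (Y, w'))
| move_r X q Y w Y' q' w' :
    act Y w q Y' w' q' -> move ((X, q), (Y, w)) ((X, q'), (Y', w')).

(** The number of moves is recorded since it is the measure of the fairness argument in
    [subtyping_reach]. *)
Inductive reach : nat -> config L -> Prop :=
| reach_success c : successful c -> reach 0 c
| reach_move n c c' : move c c' -> reach n c' -> reach (S n) c.

Definition correct (c : config L) : Prop :=
  forall c', clos_refl_trans_1n _ move c c' -> exists n, reach n c'.

Definition cwf (c : config L) : Prop :=
  match c with ((X, _), (Y, _)) => wf_term X /\ wf_term Y end.

Definition unfold_eq (c d : config L) : Prop :=
  match c, d with
  | ((X, q), (Y, w)), ((X', q'), (Y', w')) =>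
      unfold X = unfold X' /\ unfold Y = unfold Y' /\ q = q' /\ w = w'
  end.

Lemma unfold_eq_trans c d e : unfold_eq c d -> unfold_eq d e -> unfold_eq c e.
Proof.
  destruct c as [[? ?] [? ?]], d as [[? ?] [? ?]], e as [[? ?] [? ?]]; simpl.
  intuition congruence.
Qed.

Lemma unfold_eq_refl c : unfold_eq c c.
Proof. destruct c as [[? ?] [? ?]]; simpl; auto. Qed.

Lemma unfold_eq_sym c d : unfold_eq c d -> unfold_eq d c.
Proof.
  destruct c as [[? ?] [? ?]], d as [[? ?] [? ?]]; simpl; intuition congruence.
Qed.

Lemma move_cwf c c' : cwf c -> move c c' -> cwf c'.
Proof.
  intros Hc H; destruct H; simpl in *; destruct Hc; split; auto;
    (eapply act_wf; [|eassumption]; auto).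
Qed.

Lemma move_step c c' : move c c' -> step c c'.
Proof.
  intros [X q Y w X' q' w' H|X q Y w Y' q' w' H]; inversion H; subst;
    [apply step_unfold_l|apply step_unfold_l|apply step_unfold_r|apply step_unfold_r];
    match goal with E : unfold _ = _ |- _ => rewrite E end; now constructor.
Qed.

Lemma move_unfold_eq c d c' :
  unfold_eq c d -> move c c' -> exists d', move d d' /\ unfold_eq c' d'.
Proof.
  destruct d as [[X2 q2] [Y2 w2]]; intros E H; destruct H; simpl in E;
    destruct E as [EX [EY [-> ->]]].
  - eexists; split; [apply move_l; eapply act_unfold_eq; eauto|simpl; auto].
  - eexists; split; [apply move_r; eapply act_unfold_eq; eauto|simpl; auto].
Qed.

(* A step of one side may also replace the other side by its unfolding. *)
Lemma step_move c c' :
  cwf c -> step c c' -> cwf c' /\ exists d', move c d' /\ unfold_eq c' d'.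
Proof.
  intros Hc H; induction H; simpl in Hc; destruct Hc as [H1 H2].
  - split; [simpl; eauto using wf_branch_Sel|].
    eexists; split; [apply move_l; econstructor; eauto; reflexivity|apply unfold_eq_refl].
  - split; [simpl; eauto using wf_branch_Bra|].
    eexists; split; [apply move_l; econstructor; eauto; reflexivity|apply unfold_eq_refl].
  - destruct IHstep as [Hs [d' [Hd E]]]; [simpl; auto using wf_unfold|].
    split; auto.
    destruct (move_unfold_eq ((unfold T1, w1), (T2, w2)) ((T1, w1), (T2, w2)) d')
      as [e [He E']]; [simpl; auto using unfold_unfold|exact Hd|].
    exists e; split; auto; eapply unfold_eq_trans; eauto.
  - split; [simpl; eauto using wf_branch_Sel|].
    eexists; split; [apply move_r; econstructor; eauto; reflexivity|apply unfold_eq_refl].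
  - split; [simpl; eauto using wf_branch_Bra|].
    eexists; split; [apply move_r; econstructor; eauto; reflexivity|apply unfold_eq_refl].
  - destruct IHstep as [Hs [d' [Hd E]]]; [simpl; auto using wf_unfold|].
    split; auto.
    destruct (move_unfold_eq ((T1, w1), (unfold T2, w2)) ((T1, w1), (T2, w2)) d')
      as [e [He E']]; [simpl; auto using unfold_unfold|exact Hd|].
    exists e; split; auto; eapply unfold_eq_trans; eauto.
Qed.

Lemma successful_unfold_eq c d : unfold_eq c d -> successful c -> successful d.
Proof.
  destruct c as [[? ?] [? ?]], d as [[? ?] [? ?]]; simpl; intuition congruence.
Qed.

Lemma reach_unfold_eq n c d : unfold_eq c d -> reach n c -> reach n d.
Proof.
  intros E H; revert d E; induction H as [c H|n c c' Hm Hr IH]; intros d E.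
  - constructor; eapply successful_unfold_eq; eauto.
  - destruct (move_unfold_eq _ _ _ E Hm) as [d' [Hd E']]; econstructor; eauto.
Qed.

Lemma steps_moves c c' d : cwf c -> unfold_eq c d -> steps c c' ->
  exists d', clos_refl_trans_1n _ move d d' /\ unfold_eq c' d'.
Proof.
  intros Hc E H; apply clos_rt_rt1n_iff in H; revert d Hc E.
  induction H as [c|c c1 c' Hs Hr IH]; intros d Hc E.
  - exists d; split; auto; constructor.
  - destruct (step_move _ _ Hc Hs) as [Hc1 [d1 [Hm E1]]].
    destruct (move_unfold_eq _ _ _ E Hm) as [d2 [Hm2 E2]].
    destruct (IH d2 Hc1 (unfold_eq_trans _ _ _ E1 E2)) as [d' [Hd E']].
    exists d'; split; auto; econstructor; eauto.
Qed.

Lemma moves_steps c c' : clos_refl_trans_1n _ move c c' -> steps c c'.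
Proof.
  intros H; apply clos_rt_rt1n_iff; induction H; econstructor; eauto.
  now apply move_step.
Qed.

Lemma moves_cwf c c' : cwf c -> clos_refl_trans_1n _ move c c' -> cwf c'.
Proof. intros Hc H; revert Hc; induction H; eauto using move_cwf. Qed.

Lemma reach_moves c :
  (exists n, reach n c) <->
  exists c', clos_refl_trans_1n _ move c c' /\ successful c'.
Proof.
  split.
  - intros [n H]; induction H as [c H|n c c' Hm _ [d [Hd Hs]]].
    + exists c; split; auto; constructor.
    + exists d; split; auto; econstructor; eauto.
  - intros [c' [H Hs]]; induction H as [c|c c1 c' Hm _ IH].
    + exists 0; now constructor.
    + destruct (IH Hs) as [n Hn]; exists (S n); econstructor; eauto.
Qed.

(** Steps and moves differ only by unfoldings, which success does not see; well-formedness makes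
    unfolding idempotent. *)
Lemma correct_composition_iff c : cwf c -> correct_composition c <-> correct c.
Proof.
  intros Hc; split; intros H c' Hs.
  - destruct (H c' (moves_steps _ _ Hs)) as [c2 [H2 Hsucc]].
    apply (moves_cwf _ _ Hc) in Hs.
    destruct (steps_moves _ _ _ Hs (unfold_eq_refl c') H2) as [d [Hd E]].
    apply reach_moves; exists d; split; auto; eapply successful_unfold_eq; eauto.
  - destruct (steps_moves _ _ _ Hc (unfold_eq_refl c) Hs) as [d [Hd E]].
    destruct (H d Hd) as [n Hn].
    apply (reach_unfold_eq _ _ c') in Hn; [|now apply unfold_eq_sym].
    destruct (proj1 (reach_moves c') (ex_intro _ n Hn)) as [c2 [H2 Hsucc]].
    exists c2; split; auto; now apply moves_steps.
Qed.

Lemma correct_move c c' : correct c -> move c c' -> correct c'.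
Proof. intros H Hm d Hd; apply H; econstructor; eauto. Qed.

Lemma correct_reach c : correct c -> exists n, reach n c.
Proof. intros H; apply H; constructor. Qed.

Lemma correct_coind (I : config L -> Prop) :
  (forall c, I c -> exists n, reach n c) ->
  (forall c c', I c -> move c c' -> I c' \/ correct c') ->
  forall c, I c -> correct c.
Proof.
  intros Hr Hm c Hc d Hd; revert Hc; induction Hd as [c|c c1 d H Hd IH]; auto.
  intros Hc; destruct (Hm _ _ Hc H) as [H1|H1]; auto.
Qed.

Lemma move_inv (X : term L) q Y w c' : move ((X, q), (Y, w)) c' ->
  (exists X' q' w', c' = ((X', q'), (Y, w')) /\ act X q w X' q' w') \/
  (exists Y' q' w', c' = ((X, q'), (Y', w')) /\ act Y w q Y' w' q').
Proof. intros H; inversion H; subst; [left|right]; eauto 6. Qed.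

Lemma act_teq Y Y' w q Y1 w1 q1 :
  teq Y Y' -> act Y w q Y1 w1 q1 ->
  exists Y1', act Y' w q Y1' w1 q1 /\ teq Y1 Y1'.
Proof.
  intros E H; inversion H; subst.
  - destruct (teq_Sel _ _ _ _ _ E H0 H1) as [cs [Q' [E' [Hin HQ]]]].
    exists Q'; split; auto; econstructor; eauto.
  - destruct (teq_Bra _ _ _ _ _ E H0 H1) as [cs [Q' [E' [Hin HQ]]]].
    exists Q'; split; auto; econstructor; eauto.
Qed.

(** Tree equality is a bisimulation in lockstep, so even the length of the path is preserved. *)
Lemma reach_teq n X q Y Y' w :
  teq Y Y' -> reach n ((X, q), (Y, w)) -> reach n ((X, q), (Y', w)).
Proof.
  intros E H; remember ((X, q), (Y, w)) as c eqn:Ec; revert X q Y Y' w E Ec.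
  induction H as [c H|n c c' Hm Hr IH]; intros X q Y Y' w E ->.
  - constructor; simpl in *; intuition eauto using teq_End.
  - apply move_inv in Hm as [[X' [q' [w' [-> Ha]]]]|[Y1 [q' [w' [-> Ha]]]]].
    + econstructor; [apply move_l; eauto|eauto].
    + destruct (act_teq _ _ _ _ _ _ _ E Ha) as [Y1' [Ha' E']].
      econstructor; [apply move_r; eauto|eauto].
Qed.

Lemma correct_teq X q Y Y' w :
  teq Y Y' -> correct ((X, q), (Y, w)) -> correct ((X, q), (Y', w)).
Proof.
  intros E H.
  apply (correct_coind (fun c => exists X q Y Y' w,
    c = ((X, q), (Y', w)) /\ teq Y Y' /\ correct ((X, q), (Y, w)))).
  - clear; intros c [X [q [Y [Y' [w [-> [E H]]]]]]].
    destruct (correct_reach _ H) as [n Hn]; exists n; eapply reach_teq; eauto.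
  - clear; intros c c' [X [q [Y [Y' [w [-> [E H]]]]]]] Hm; left.
    apply move_inv in Hm as [[X' [q' [w' [-> Ha]]]]|[Y1 [q' [w' [-> Ha]]]]].
    + exists X', q', Y, Y', w'; repeat split; auto.
      eapply correct_move; eauto; now apply move_l.
    + destruct (act_teq _ _ _ _ _ _ _ (teq_sym _ _ E) Ha) as [Y2 [Ha' E']].
      exists X, q', Y2, Y1, w'; repeat split; auto; [now apply teq_sym|].
      eapply correct_move; eauto; now apply move_r.
  - exists X, q, Y, Y', w; auto.
Qed.

(* Reading a message commutes with every move of the partner. *)
Lemma correct_read X q Y w bs l Y' :
  wf_term Y -> unfold Y = Bra bs -> In (l, Y') bs ->
  correct ((X, q), (Y', w)) -> correct ((X, q), (Y, l :: w)).
Proof.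
  intros HY E Hin H.
  apply (correct_coind (fun c => exists X q w,
    c = ((X, q), (Y, l :: w)) /\ correct ((X, q), (Y', w)))).
  - intros c [X1 [q1 [w1 [-> H1]]]].
    destruct (correct_reach _ H1) as [n Hn]; exists (S n).
    econstructor; [apply move_r; eapply act_in; eauto|auto].
  - intros c c' [X1 [q1 [w1 [-> H1]]]] Hm.
    apply move_inv in Hm as [[X' [q' [w' [-> Ha]]]]|[Y2 [q' [w' [-> Ha]]]]].
    + left; inversion Ha; subst; do 3 eexists; split; try reflexivity;
        eapply correct_move; eauto; apply move_l; econstructor; eauto.
    + right; inversion Ha; subst; [congruence|].
      match goal with E' : unfold Y = Bra ?b |- _ =>
        rewrite E in E'; inversion E'; subst b end.
      assert (Hb := wf_unfold _ HY); rewrite E in Hb.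
      now rewrite (Bra_branch_eq bs l Y2 Y').
  - eauto.
Qed.

End Semantics.

(** * Anticipating an output that lies behind an input context *)

Section Anticipation.
Context {L : Type}.
Implicit Types (X P U : term L) (q w : list L) (Q : L -> term L) (I : L -> Prop).

(* [P = A[(+){l : S_kl}]] and [Q l = A[S_kl]] for an input context [A] all of whose
   holes offer the outputs in [I]. *)
Inductive antic (I : L -> Prop) : term L -> (L -> term L) -> Prop :=
| antic_hole B Q : closed (Sel B) ->
    (forall l U, In (l, U) B <-> I l /\ U = Q l) -> antic I (Sel B) Q
| antic_bra (bs : list (L * (term L * (L -> term L)))) Q :
    (forall m P F, In (m, (P, F)) bs -> antic I P F) ->
    (forall l, Q l = Bra (map (on_snd (fun p => snd p l)) bs)) ->
    antic I (Bra (map (on_snd fst) bs)) Q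
| antic_mu P F Q :
    antic I P F -> (forall l, Q l = Mu (F l)) -> antic I (Mu P) Q
| antic_var n Q : (forall l, Q l = Var n) -> antic I (Var n) Q.

Lemma closed_branch_Sel (B : list (L * term L)) l U :
  closed (Sel B) -> In (l, U) B -> closed U.
Proof.
  intros H Hin n; destruct (free n U) eqn:E; auto.
  specialize (H n); simpl in H; now rewrite (free_branches_In _ _ _ _ Hin E) in H.
Qed.

Lemma antic_hole_subst I B Q s (t : L -> nat -> term L) : closed (Sel B) ->
  (forall l U, In (l, U) B <-> I l /\ U = Q l) ->
  antic I (subst s (Sel B)) (fun l => subst (t l) (Q l)).
Proof.
  intros HB H; rewrite subst_closed by auto; constructor; auto.
  intros l U; rewrite H; split; intros [Hl ->]; split; auto.
  all: rewrite subst_closed; auto; apply (closed_branch_Sel B l); auto.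
  all: apply H; auto.
Qed.

Lemma antic_ext I P Q Q' : antic I P Q -> (forall l, Q' l = Q l) -> antic I P Q'.
Proof.
  intros H E; destruct H.
  - constructor; auto; intros l U; now rewrite E.
  - econstructor; eauto; intros l; rewrite E; auto.
  - econstructor; eauto; intros l; rewrite E; auto.
  - constructor; intros l; rewrite E; auto.
Qed.

(** The class [C] allows two uses of one induction: crossing a binder renames the substituted terms,
    so renamings must be treated before arbitrary substitutions. *)
Lemma antic_subst_class I (C : (nat -> term L) -> (L -> nat -> term L) -> Prop) :
  (forall s t, C s t -> C (up s) (fun l => up (t l))) ->
  (forall s t n, C s t -> antic I (s n) (fun l => t l n)) ->
  forall P Q, antic I P Q ->
  forall s t, C s t -> antic I (subst s P) (fun l => subst (t l) (Q l)).
Proof.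
  intros Hup Hv P Q H; induction H as [B Q HB HU|bs Q _ IH HQ|P F Q _ IH HQ|n Q HQ];
    intros s t HC.
  - now apply antic_hole_subst.
  - pose (f := fun p : term L * (L -> term L) =>
                 (subst s (fst p), fun l => subst (t l) (snd p l))).
    replace (subst s (Bra (map (on_snd fst) bs)))
      with (Bra (map (on_snd fst) (map (on_snd f) bs)))
      by (simpl; now rewrite !map_on_snd_map).
    constructor.
    + intros m P F Hin; apply in_map_on_snd in Hin as [[P' F'] [E Hin]].
      inversion E; subst; now apply (IH m P' F').
    + intros l; rewrite HQ; simpl; now rewrite !map_on_snd_map.
  - simpl; eapply antic_mu; [apply IH, Hup, HC|].
    intros l; now rewrite HQ.
  - simpl; apply (antic_ext _ _ (fun l => t l n)); auto.
    intros l; now rewrite HQ.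
Qed.

Lemma antic_rename I P Q r :
  antic I P Q -> antic I (rename r P) (fun l => rename r (Q l)).
Proof.
  intros H; rewrite rename_as_subst.
  apply (antic_ext _ _ (fun l => subst (fun n => Var (r n)) (Q l)));
    [|intros l; apply rename_as_subst].
  apply (antic_subst_class I (fun s t =>
    exists r, forall n, s n = Var (r n) /\ forall l, t l n = Var (r n)))
    with (t := fun _ n => Var (r n)); auto.
  - intros s t [r' Hr]; exists (up_ren r'); intros [|n]; simpl; auto.
    destruct (Hr n) as [-> Ht]; split; auto; intros l; now rewrite Ht.
  - intros s t n [r' Hr]; destruct (Hr n) as [-> Ht]; now constructor.
  - now exists r.
Qed.

Lemma antic_subst I P Q s (t : L -> nat -> term L) :
  antic I P Q -> (forall n, antic I (s n) (fun l => t l n)) ->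
  antic I (subst s P) (fun l => subst (t l) (Q l)).
Proof.
  intros H Hs; apply (antic_subst_class I (fun s t =>
    forall n, antic I (s n) (fun l => t l n))); auto.
  clear; intros s t H [|n]; simpl; [now constructor|].
  now apply (antic_rename I _ (fun l => t l n)).
Qed.

(** A recursion unfolds on both sides at once, since [antic_subst] may put related recursions for
    the bound variable. At a hole only unfoldings agree: [Q l] may still carry vacuous binders
    around [U]. The last alternative remains because [P] may be open. *)
Lemma antic_unfold I P Q :
  wf_term P -> (forall l, I l -> wf_term (Q l)) -> antic I P Q ->
  (exists B, unfold P = Sel B /\
     (forall l U, In (l, U) B -> I l /\ unfold (Q l) = unfold U) /\
     (forall l, I l -> exists U, In (l, U) B)) \/
  (exists bs, unfold P = Bra (map (on_snd fst) bs) /\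
     (forall l, I l -> unfold (Q l) = Bra (map (on_snd (fun p => snd p l)) bs)) /\
     (forall m P' F, In (m, (P', F)) bs -> antic I P' F)) \/
  (exists n, unfold P = Var n).
Proof.
  intros HP; revert Q; pattern P, (unfold P); apply unfold_ind; auto; clear P HP.
  - intros P Hl Q HQ H; destruct H as [B Q HB HU|bs Q H HE|P F Q H HE|n Q HE].
    + left; exists B; repeat split.
      * now apply HU in H.
      * now apply HU in H as [_ ->].
      * intros l Hi; exists (Q l); now apply HU.
    + right; left; exists bs; repeat split; auto.
      intros l _; now rewrite HE.
    + discriminate.
    + eauto.
  - intros U V HU IH Q HQ H; inversion H as [| |P F Q' HF HE|]; subst.
    (* As [Q l = Mu (F l)], this family is [Q] unfolded once. *)
    destruct (IH (fun l => inst (Q l) (F l))) as [[B [E [H1 H2]]]|[[bs [E [H1 H2]]]|H1]];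
      auto.
    + intros l Hi; specialize (HQ l Hi); rewrite HE in *; now apply wf_inst.
    + apply (antic_subst I U F _ (fun l n => match n with 0 => Q l | S m => Var m end));
        auto; intros [|n]; auto; now constructor.
    + left; exists B; repeat split; auto.
      * now apply H1 in H0.
      * apply H1 in H0 as [Hi <-]; specialize (HQ l Hi); rewrite HE in *.
        inversion HQ; subst; now apply unfold_Mu.
    + right; left; exists bs; repeat split; auto.
      intros l Hi; rewrite <- H1 by auto; specialize (HQ l Hi); rewrite HE in *.
      inversion HQ; subst; now apply unfold_Mu.
Qed.

Lemma antic_branch_wf I P Q bs m P' F :
  wf_term P -> (forall l, I l -> wf_term (Q l)) ->
  unfold P = Bra (map (on_snd fst) bs) ->
  (forall l, I l -> unfold (Q l) = Bra (map (on_snd (fun p => snd p l)) bs)) ->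
  In (m, (P', F)) bs -> wf_term P' /\ forall l, I l -> wf_term (F l).
Proof.
  intros HP HQ EP EQ Hin; split.
  - apply wf_unfold in HP; rewrite EP in HP; eapply wf_branch_Bra; eauto.
    apply in_map_on_snd; exists (P', F); eauto.
  - intros l Hi; specialize (HQ l Hi); apply wf_unfold in HQ.
    rewrite EQ in HQ by auto; eapply wf_branch_Bra; eauto.
    apply in_map_on_snd; exists (P', F); eauto.
Qed.

(* The output performed at the hole reached by the given path is the one to
   anticipate: this path then gets shorter by one move. *)
Lemma antic_reach_shorter I n X q P w Q :
  wf_term P -> (forall l, I l -> wf_term (Q l)) -> antic I P Q ->
  reach n ((X, q), (P, w)) ->
  exists l m, I l /\ m < n /\ reach m ((X, q ++ [l]), (Q l, w)).
Proof.
  intros HP HQ HA H; remember ((X, q), (P, w)) as c eqn:Ec.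
  revert X q P w Q HP HQ HA Ec.
  induction H as [c H|n c c' Hm Hr IH]; intros X q P w Q HP HQ HA ->.
  - destruct H as [_ [HE _]].
    destruct (antic_unfold _ _ _ HP HQ HA) as [[B [E _]]|[[bs [E _]]|[k E]]]; congruence.
  - apply move_inv in Hm as [[X' [q' [w' [-> Ha]]]]|[P1 [q' [w' [-> Ha]]]]].
    + destruct (IH X' q' P w' Q) as [l [m [Hi [Hlt Hr']]]]; auto.
      exists l, (S m); repeat split; auto; [lia|].
      econstructor; [apply move_l|exact Hr'].
      inversion Ha; subst; simpl; econstructor; eauto.
    + destruct (antic_unfold _ _ _ HP HQ HA)
        as [[B [E [H1 _]]]|[[bs [E [H1 H2]]]|[k E]]];
        inversion Ha; subst; try congruence.
      * assert (bs = B) by congruence; subst bs.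
        match goal with Hin : In (l, P1) B |- _ =>
          destruct (H1 _ _ Hin) as [Hi EU] end.
        exists l, n; repeat split; auto.
        eapply reach_teq; [apply teq_unfold_eq; symmetry; exact EU|auto].
      * assert (bs0 = map (on_snd fst) bs) by congruence; subst bs0.
        match goal with Hl : In (_, P1) _ |- _ =>
          apply in_map_on_snd in Hl as [[P' F] [EP Hin]]; simpl in EP; subst P' end.
        destruct (antic_branch_wf _ _ _ _ _ _ _ HP HQ E H1 Hin) as [HP1 HF].
        destruct (IH X q' P1 w' F) as [l' [m [Hi [Hlt Hr']]]]; eauto.
        exists l', (S m); repeat split; auto; [lia|].
        econstructor; [apply move_r|exact Hr'].
        eapply act_in; [apply H1; auto|].
        apply in_map_on_snd; exists (P1, F); eauto.
Qed.

Lemma antic_hole_move I X q P w Q B l :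
  (forall l U, In (l, U) B -> I l /\ unfold (Q l) = unfold U) ->
  (forall l, I l -> exists U, In (l, U) B) ->
  unfold P = Sel B -> I l -> correct ((X, q), (P, w)) ->
  correct ((X, q ++ [l]), (Q l, w)).
Proof.
  intros H1 H2 E Hi H; destruct (H2 l Hi) as [U Hin].
  apply (correct_teq _ _ U).
  - apply teq_unfold_eq; symmetry; now apply H1.
  - eapply correct_move; eauto; apply move_r; econstructor; eauto.
Qed.

(** Here the label is imposed and may differ from the one sent on the path. The path is followed
    only until [P] stands at a hole, where correctness supplies a new path after the output [l]. *)
Lemma antic_reach I n X q P w Q l :
  wf_term P -> (forall l, I l -> wf_term (Q l)) -> antic I P Q -> I l ->
  correct ((X, q), (P, w)) -> reach n ((X, q), (P, w)) ->
  exists m, reach m ((X, q ++ [l]), (Q l, w)).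
Proof.
  intros HP HQ HA Hi HC H; remember ((X, q), (P, w)) as c eqn:Ec.
  revert X q P w Q HP HQ HA HC Ec.
  induction H as [c H|n c c' Hm Hr IH]; intros X q P w Q HP HQ HA HC ->.
  - destruct H as [_ [HE _]].
    destruct (antic_unfold _ _ _ HP HQ HA) as [[B [E _]]|[[bs [E _]]|[k E]]]; congruence.
  - assert (HC' := correct_move _ _ HC Hm).
    apply move_inv in Hm as [[X' [q' [w' [-> Ha]]]]|[P1 [q' [w' [-> Ha]]]]].
    + destruct (IH X' q' P w' Q) as [m Hr']; auto.
      exists (S m); econstructor; [apply move_l|exact Hr'].
      inversion Ha; subst; simpl; econstructor; eauto.
    + destruct (antic_unfold _ _ _ HP HQ HA)
        as [[B [E [H1 H2]]]|[[bs [E [H1 H2]]]|[k E]]].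
      * apply correct_reach; eapply antic_hole_move; eauto.
      * inversion Ha; subst; try congruence.
        assert (bs0 = map (on_snd fst) bs) by congruence; subst bs0.
        match goal with Hl : In (_, P1) _ |- _ =>
          apply in_map_on_snd in Hl as [[P' F] [EP Hin]]; simpl in EP; subst P' end.
        destruct (antic_branch_wf _ _ _ _ _ _ _ HP HQ E H1 Hin) as [HP1 HF].
        destruct (IH X q' P1 w' F) as [m Hr']; eauto.
        exists (S m); econstructor; [apply move_r|exact Hr'].
        eapply act_in; [apply H1; auto|].
        apply in_map_on_snd; exists (P1, F); eauto.
      * inversion Ha; subst; congruence.
Qed.

(* [X] waits on an empty queue for the anticipated output, hence [P] alone moves
   until it reaches a hole. *)
Lemma antic_wait I n X xs X1 P w Q l :
  unfold X = Bra xs -> In (l, X1) xs ->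
  wf_term P -> (forall l, I l -> wf_term (Q l)) -> antic I P Q -> I l ->
  correct ((X, []), (P, w)) -> reach n ((X, []), (P, w)) ->
  correct ((X1, []), (Q l, w)).
Proof.
  intros EX HX HP HQ HA Hi HC H; remember ((X, []), (P, w)) as c eqn:Ec.
  revert P w Q HP HQ HA HC Ec.
  induction H as [c H|n c c' Hm Hr IH]; intros P w Q HP HQ HA HC ->.
  - destruct H as [HE _]; congruence.
  - assert (HC' := correct_move _ _ HC Hm).
    apply move_inv in Hm as [[X' [q' [w' [-> Ha]]]]|[P1 [q' [w' [-> Ha]]]]].
    + inversion Ha; subst; congruence.
    + destruct (antic_unfold _ _ _ HP HQ HA)
        as [[B [E [H1 H2]]]|[[bs [E [H1 H2]]]|[k E]]].
      * assert (HC1 := antic_hole_move _ _ _ _ _ _ _ _ H1 H2 E Hi HC).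
        eapply correct_move; [exact HC1|]; apply move_l; eapply act_in; eauto.
      * inversion Ha; subst; try congruence.
        assert (bs0 = map (on_snd fst) bs) by congruence; subst bs0.
        match goal with Hl : In (_, P1) _ |- _ =>
          apply in_map_on_snd in Hl as [[P' F] [EP Hin]]; simpl in EP; subst P' end.
        destruct (antic_branch_wf _ _ _ _ _ _ _ HP HQ E H1 Hin) as [HP1 HF].
        apply correct_read with (map (on_snd (fun p => snd p l)) bs) (F l); auto.
        -- apply in_map_on_snd; exists (P1, F); eauto.
        -- apply IH with (P := P1); eauto.
      * inversion Ha; subst; congruence.
Qed.

Lemma reach_Var n X q P w k :
  unfold P = Var k -> ~ reach n ((X, q), (P, w)).
Proof.
  intros E Hn; remember ((X, q), (P, w)) as c eqn:Ec; revert X q w Ec.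
  induction Hn as [c Hc|n c c' Hm Hr IH]; intros X q w ->.
  - destruct Hc as [_ [Hc _]]; congruence.
  - apply move_inv in Hm as [[X' [q' [w' [-> Ha]]]]|[P1 [q' [w' [-> Ha]]]]].
    + eapply IH; eauto.
    + inversion Ha; congruence.
Qed.

(** The invariant says that [l] is still the last of the messages that [P] has sent ahead. It is
    left when [X] reads [l], or when the anticipated term moves with [P] at a hole. *)
Lemma correct_antic I X q P w Q l :
  wf_term P -> (forall l, I l -> wf_term (Q l)) -> antic I P Q -> I l ->
  correct ((X, q), (P, w)) -> correct ((X, q ++ [l]), (Q l, w)).
Proof.
  intros HP HQ HA Hi H.
  apply (correct_coind (fun c => exists X q P w Q,
    c = ((X, q ++ [l]), (Q l, w)) /\ wf_term P /\ (forall l, I l -> wf_term (Q l)) /\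
    antic I P Q /\ correct ((X, q), (P, w)))); [| |eauto 10].
  - clear X q P w Q HP HQ HA H.
    intros c [X [q [P [w [Q [-> [HP [HQ [HA H]]]]]]]]].
    destruct (correct_reach _ H) as [n Hn]; eapply antic_reach; eauto.
  - clear X q P w Q HP HQ HA H.
    intros c c' [X [q [P [w [Q [-> [HP [HQ [HA H]]]]]]]]] Hm.
    apply move_inv in Hm as [[X' [q' [w' [-> Ha]]]]|[Q1 [q' [w' [-> Ha]]]]].
    + inversion Ha as [? bs k ? ? ? E Hin|? bs k ? ? ? E Hin]; subst.
      * left; exists X', q, P, (w ++ [k]), Q; repeat split; auto.
        eapply correct_move; eauto; apply move_l; econstructor; eauto.
      (* With [q] empty, the message read is the anticipated one; otherwise it comes from [q], and
         [P] allows the same move. *)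
      * destruct q as [|k' q]; simpl in *.
        -- match goal with Eq : _ :: _ = _ :: _ |- _ => inversion Eq; subst end.
           right.
           destruct (correct_reach _ H) as [n Hn]; eapply antic_wait; eauto.
        -- match goal with Eq : _ :: _ = _ :: _ |- _ => inversion Eq; subst end.
           left; exists X', q, P, w', Q; repeat split; auto.
           eapply correct_move; eauto; apply move_l; econstructor; eauto.
    + destruct (antic_unfold _ _ _ HP HQ HA)
        as [[B [E [H1 H2]]]|[[bs [E [H1 H2]]]|[k E]]].
      * right; eapply correct_move; [eapply antic_hole_move; eauto|].
        now apply move_r.
      * left; specialize (H1 l Hi) as EQ.
        inversion Ha as [? cs k ? ? ? E' Hin|? cs k ? ? ? E' Hin]; subst; try congruence.
        rewrite EQ in E'; inversion E'; subst cs.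
        apply in_map_on_snd in Hin as [[P1 F] [EF Hin]]; simpl in EF; subst Q1.
        destruct (antic_branch_wf _ _ _ _ _ _ _ HP HQ E H1 Hin) as [HP1 HF].
        exists X, q, P1, w', F; repeat split; eauto.
        eapply correct_move; eauto; apply move_r; eapply act_in; eauto.
        apply in_map_on_snd; exists (P1, F); eauto.
      * destruct (correct_reach _ H) as [n Hn].
        now apply (reach_Var _ _ _ _ _ _ E) in Hn.
Qed.

Fixpoint ictx_nested_ind (P : ictx L -> Prop)
    (HHole : forall k, P (@CHole L k))
    (HBra : forall bs, (forall l A, In (l, A) bs -> P A) -> P (CBra bs))
    (HMu : forall A, P A -> P (CMu A))
    (HVar : forall n, P (@CVar L n)) (A : ictx L) {struct A} : P A :=
  match A with
  | CHole k => HHole k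
  | CBra bs =>
      HBra bs ((fix branches (bs : list (L * ictx L)) :
                  forall l A, In (l, A) bs -> P A :=
        match bs return forall l A, In (l, A) bs -> P A with
        | [] => fun l A H => False_ind _ H
        | (l0, A0) :: bs' => fun l A H =>
            match H with
            | or_introl e =>
                eq_ind A0 P (ictx_nested_ind P HHole HBra HMu HVar A0) A
                       (f_equal snd e)
            | or_intror H' => branches bs' l A H'
            end
        end) bs)
  | CMu A' => HMu A' (ictx_nested_ind P HHole HBra HMu HVar A')
  | CVar n => HVar n
  end.

Lemma antic_fill I (A : ictx L) (B : nat -> list (L * term L)) (Sf : nat -> L -> term L) :
  (forall k, In k (holes A) -> closed (Sel (B k)) /\
     forall l U, In (l, U) (B k) <-> I l /\ U = Sf k l) ->
  antic I (fill A (fun k => Sel (B k))) (fun l => fill A (fun k => Sf k l)).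
Proof.
  induction A as [k|bs IH|A IH|n] using ictx_nested_ind; simpl; intros H.
  - destruct (H k); [auto|]; now constructor.
  - pose (f := fun A => (fill A (fun k => Sel (B k)), fun l => fill A (fun k => Sf k l))).
    replace (map (on_snd (fun A' => fill A' (fun k => Sel (B k)))) bs)
      with (map (on_snd fst) (map (on_snd f) bs)) by (now rewrite map_on_snd_map).
    constructor.
    + intros m P F Hin; apply in_map_on_snd in Hin as [A [E Hin]].
      inversion E; subst; apply (IH m A Hin).
      intros k Hk; apply H, in_flat_map; now exists (m, A).
    + intros l; now rewrite map_on_snd_map.
  - eapply antic_mu; [apply IH, H|reflexivity].
  - now constructor.
Qed.

End Anticipation.

(** * Controllability of the types occurring in correct configurations *)

Section Controllability.
Context {L : Type}.
Implicit Types (X Y T U : term L) (q w u : list L).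

(* A path to success makes [X] read all of [q], which needs no move of [Y]. *)
Lemma drain n X q q' Y w Y0 w0 :
  session X -> reach n ((X, q ++ q'), (Y, w)) ->
  exists X' v, session X' /\
    clos_refl_trans_1n _ move ((X, q), (Y0, w0)) ((X', []), (Y0, w0 ++ v)).
Proof.
  intros HX H; remember ((X, q ++ q'), (Y, w)) as c eqn:Ec.
  revert X q q' Y w w0 HX Ec.
  induction H as [c H|n c c' Hm Hr IH]; intros X q q' Y w w0 HX ->.
  - destruct H as [_ [_ [Hq _]]]; apply app_eq_nil in Hq as [-> _].
    exists X, []; rewrite app_nil_r; split; auto; constructor.
  - apply move_inv in Hm as [[X1 [q1 [w1 [-> Ha]]]]|[Y1 [q1 [w1 [-> Ha]]]]].
    + assert (HX1 := act_session _ _ _ _ _ _ HX Ha).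
      inversion Ha as [? bs l ? ? ? E Hin|? bs l ? ? ? E Hin]; subst.
      * destruct (IH X1 q q' Y (w ++ [l]) (w0 ++ [l])) as [X' [v [HX' Hs]]]; auto.
        exists X', (l :: v); split; auto; rewrite <- app_assoc in Hs.
        econstructor; [apply move_l; econstructor; eauto|exact Hs].
      * destruct q as [|l' q]; simpl in *.
        -- exists X, []; rewrite app_nil_r; split; auto; constructor.
        -- match goal with E : _ :: _ = _ :: _ |- _ => inversion E; subst end.
           destruct (IH X1 q q' Y w1 w0) as [X' [v [HX' Hs]]]; auto.
           exists X', v; split; auto.
           econstructor; [apply move_l; eapply act_in; eauto|exact Hs].
    + inversion Ha; subst.
      (* What [Y] sends along the path is put into [q'], which the constructed run never reads. *)
      * rewrite <- app_assoc in IH; eapply IH; eauto.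
      * eapply IH; eauto.
Qed.

Definition send_all (u : list L) X : term L :=
  fold_right (fun l U => Sel [(l, U)]) X u.

Lemma session_send_all u X : session X -> session (send_all u X).
Proof.
  intros HX; induction u as [|l u [IH1 IH2]]; simpl; auto; split.
  - constructor; [discriminate|constructor; [auto|constructor]|].
    intros l' T [E|[]]; inversion E; now subst.
  - intros n; simpl; now rewrite IH2.
Qed.

(** While [X] is delayed, [Y] only reads from the front of its queue or sends; the queue followed by
    the labels still to be sent evolves as in the original configuration. *)
Lemma correct_send_all u X q Y w :
  correct ((X, q), (Y, w ++ u)) -> correct ((send_all u X, q), (Y, w)).
Proof.
  intros H.
  apply (correct_coind (fun c => exists u q Y w,
    c = ((send_all u X, q), (Y, w)) /\ correct ((X, q), (Y, w ++ u)))).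
  - clear; intros c [u [q [Y [w [-> H]]]]].
    revert w H; induction u as [|l u IH]; simpl; intros w H.
    + rewrite app_nil_r in H; now apply correct_reach.
    + destruct (IH (w ++ [l])) as [n Hn]; [now rewrite <- app_assoc|].
      exists (S n); econstructor; [|exact Hn].
      apply move_l; econstructor; [reflexivity|now left].
  - clear; intros c c' [u [q [Y [w [-> H]]]]] Hm.
    apply move_inv in Hm as [[X1 [q1 [w1 [-> Ha]]]]|[Y1 [q1 [w1 [-> Ha]]]]].
    + destruct u as [|l u]; simpl in *.
      * right; rewrite app_nil_r in H; eapply correct_move; eauto; now apply move_l.
      * left; inversion Ha as [? bs k ? ? ? E Hin|? bs k ? ? ? E Hin]; subst;
          unfold unfold in E; simpl in E; inversion E; subst.
        destruct Hin as [E'|[]]; inversion E'; subst.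
        exists u, q1, Y, (w ++ [k]); split; auto; now rewrite <- app_assoc.
    + left; exists u, q1, Y1, w1; split; auto.
      eapply correct_move; eauto; apply move_r.
      inversion Ha; subst; simpl; econstructor; eauto.
  - eauto 6.
Qed.

(** Compliance starts from empty queues. Draining gives a partner whose own queue is empty, without
    moving [Y]; prefixing sends then recreates the queue of [Y]. *)
Lemma correct_controllable X q Y w :
  session X -> wf_term Y -> correct ((X, q), (Y, w)) -> controllable Y.
Proof.
  intros HX HY H; destruct (correct_reach _ H) as [n Hn].
  rewrite <- (app_nil_r q) in Hn.
  destruct (drain n X q [] Y w Y w HX Hn) as [X' [v [HX' Hs]]].
  exists (send_all (w ++ v) X'); assert (HS := session_send_all (w ++ v) X' HX').
  split; auto; unfold compliant.
  apply correct_composition_iff; [split; auto; apply HS|].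
  apply correct_send_all; simpl.
  intros d Hd; apply H.
  apply clos_rt_rt1n_iff; apply clos_rt_rt1n_iff in Hs, Hd.
  eapply rt_trans; eauto.
Qed.

End Controllability.

(** * Replacing a type by a subtype in a correct configuration *)

Section Subtyping.
Context {L : Type}.
Implicit Types (X T S P : term L) (q w : list L) (R : term L -> term L -> Prop).

Lemma subtyping_unfold R T S :
  controllable_subtyping_relation R -> R T S -> R (unfold T) S.
Proof.
  intros HR H; destruct (HR _ _ H) as [[HT _] _]; revert H.
  pattern T, (unfold T); apply unfold_ind; auto.
  intros U V _ IH H; apply IH; now apply (HR _ _ H).
Qed.

Lemma subtyping_End R T S :
  controllable_subtyping_relation R -> R T S -> unfold T = End -> unfold S = End.
Proof.
  intros HR H E; apply subtyping_unfold in H; auto.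
  destruct (HR _ _ H) as [_ [_ [HE _]]]; auto.
Qed.

Lemma subtyping_Bra R T S bs :
  controllable_subtyping_relation R -> R T S -> unfold T = Bra bs ->
  exists cs, unfold S = Bra cs /\
    forall l S', In (l, S') cs -> controllable S' ->
      exists T', In (l, T') bs /\ R T' S'.
Proof.
  intros HR H E; apply subtyping_unfold in H; auto.
  destruct (HR _ _ H) as [_ [_ [_ [_ [HB _]]]]]; auto.
Qed.

Lemma subtyping_Sel R T S bs :
  controllable_subtyping_relation R -> R T S -> unfold T = Sel bs ->
  exists P Q, teq S P /\ wf_term P /\ antic (fun l => In l (labels bs)) P Q /\
    (forall l, In l (labels bs) -> wf_term (Q l)) /\
    (forall l T', In (l, T') bs -> R T' (Q l)).
Proof.
  intros HR H E; apply subtyping_unfold in H; auto.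
  destruct (HR _ _ H) as [_ [[HS _] [_ [_ [_ HO]]]]].
  destruct (HO bs E) as [A [B [Sf [_ [HB [ES HT]]]]]].
  exists (selUnfold S), (fun l => fill A (fun k => Sf k l)); repeat split.
  - now apply teq_selUnfold.
  - now apply wf_selUnfold.
  - rewrite ES; apply antic_fill; intros k Hk.
    destruct (HB k Hk) as [[_ Hc] HU]; auto.
  (* For such [l], the term [Q l] occurs in [R], which relates session types only. *)
  - intros l Hl; apply in_map_iff in Hl as [[l' T'] [El Hin]]; simpl in El; subst l'.
    now apply (HR _ _ (HT l T' Hin)).
  - exact HT.
Qed.

(** Success requires an empty queue, and moves of [X] only append to it, so [S] has to read [l]
    first. *)
Lemma correct_receives n X q S l w cs :
  unfold S = Bra cs -> reach n ((X, q), (S, l :: w)) ->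
  exists S', In (l, S') cs.
Proof.
  intros E H; remember ((X, q), (S, l :: w)) as c eqn:Ec; revert X q w Ec.
  induction H as [c H|n c c' Hm Hr IH]; intros X q w ->.
  - destruct H as [_ [HE _]]; congruence.
  - apply move_inv in Hm as [[X' [q' [w' [-> Ha]]]]|[S1 [q' [w' [-> Ha]]]]].
    + inversion Ha; subst; eapply IH; reflexivity.
    + inversion Ha; subst; try congruence.
      match goal with E' : unfold S = Bra ?b |- _ =>
        rewrite E in E'; inversion E'; subst b end; eauto.
Qed.

(** The configuration after reading is correct, so [S'] is controllable and the input clause covers
    this branch. *)
Lemma subtyping_read R X q T S l w bs cs S' :
  controllable_subtyping_relation R -> session X -> R T S ->
  unfold T = Bra bs -> unfold S = Bra cs -> In (l, S') cs ->
  correct ((X, q), (S, l :: w)) ->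
  correct ((X, q), (S', w)) /\ exists T', In (l, T') bs /\ R T' S'.
Proof.
  intros HR HX H ET ES Hin HC.
  assert (Ha : act S (l :: w) q S' w q) by (eapply act_in; eauto).
  assert (HC' : correct ((X, q), (S', w)))
    by (eapply correct_move; [exact HC|now apply move_r]).
  split; auto; destruct (subtyping_Bra R T S bs HR H ET) as [cs' [ES' HB]].
  rewrite ES in ES'; inversion ES'; subst cs'; apply HB; auto.
  eapply correct_controllable; eauto.
  eapply act_wf; eauto; apply (HR _ _ H).
Qed.

Lemma subtyping_reach R n X q T S w :
  controllable_subtyping_relation R -> session X -> R T S ->
  correct ((X, q), (S, w)) -> reach n ((X, q), (S, w)) ->
  exists m, reach m ((X, q), (T, w)).
Proof.
  intros HR; revert X q T S w; induction n as [n IH] using lt_wf_ind.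
  intros X q T S w HX H HC Hn.
  destruct (HR _ _ H) as [HT _].
  assert (HX_move : forall X' q' w', act X q w X' q' w' ->
    reach (pred n) ((X', q'), (S, w')) -> 0 < n ->
    exists m, reach m ((X, q), (T, w))).
  { intros X' q' w' Ha Hr Hlt.
    destruct (IH (pred n)) with (X := X') (q := q') (T := T) (S := S) (w := w')
      as [m Hm]; auto; [lia|exact (act_session _ _ _ _ _ _ HX Ha)| |].
    - eapply correct_move; eauto; now apply move_l.
    - exists (Datatypes.S m); econstructor; [apply move_l; eauto|auto]. }
  destruct (unfold T) as [bs|bs|U|k|] eqn:ET.
  - destruct (subtyping_Sel R T S bs HR H ET) as [P [Q [HE [HP [HA [HQ HTQ]]]]]].
    (* Passing from [S] to its selective unfolding keeps the length [n], so the strict decrease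
       obtained next feeds the induction. *)
    apply (correct_teq _ _ _ _ _ HE) in HC; apply (reach_teq _ _ _ _ _ _ HE) in Hn.
    destruct (antic_reach_shorter _ _ _ _ _ _ _ HP HQ HA Hn) as [l [m [Hl [Hlt Hm]]]].
    apply (correct_antic _ _ _ _ _ _ _ HP HQ HA Hl) in HC.
    apply in_map_iff in Hl as [[l' T'] [El Hin]]; simpl in El; subst l'.
    destruct (IH m Hlt _ _ T' _ _ HX (HTQ _ _ Hin) HC Hm) as [j Hj].
    exists (Datatypes.S j); econstructor; [apply move_r; econstructor; eauto|auto].
  - destruct (subtyping_Bra R T S bs HR H ET) as [cs [ES HB]].
    inversion Hn as [c Hs|m c c' Hm Hr]; subst.
    + destruct Hs as [_ [Hs _]]; congruence.
    + apply move_inv in Hm as [[X' [q' [w' [-> Ha]]]]|[S' [q' [w' [-> Ha]]]]].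
      * eapply HX_move; eauto; lia.
      * inversion Ha as [? ds l ? ? ? E Hin|? ds l ? ? ? E Hin]; subst; try congruence.
        rewrite ES in E; inversion E; subst ds.
        destruct (subtyping_read R X q' T S l w' bs cs S') as [HC' [T' [HinT HT']]];
          auto.
        destruct (IH m) with (X := X) (q := q') (T := T') (S := S') (w := w')
          as [j Hj]; auto.
        exists (Datatypes.S j); econstructor; [|exact Hj].
        apply move_r; eapply act_in; eauto.
  - destruct HT as [HT _]; apply lead_mu_unfold in HT; rewrite ET in HT; discriminate.
  - apply session_unfold in HT as [_ HT]; rewrite ET in HT.
    specialize (HT k); simpl in HT; now rewrite Nat.eqb_refl in HT.
  - assert (ES := subtyping_End R T S HR H ET).
    inversion Hn as [c Hs|m c c' Hm Hr]; subst.
    + exists 0; constructor; simpl in *; intuition.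
    + apply move_inv in Hm as [[X' [q' [w' [-> Ha]]]]|[S' [q' [w' [-> Ha]]]]].
      * eapply HX_move; eauto; lia.
      * inversion Ha; congruence.
Qed.

Lemma subtyping_correct R X q T S w :
  controllable_subtyping_relation R -> session X -> R T S ->
  correct ((X, q), (S, w)) -> correct ((X, q), (T, w)).
Proof.
  intros HR HX H HC.
  apply (correct_coind (fun c => exists X q T S w,
    c = ((X, q), (T, w)) /\ session X /\ R T S /\ correct ((X, q), (S, w))));
    [| |eauto 10].
  - clear - HR; intros c [X [q [T [S [w [-> [HX [H HC]]]]]]]].
    destruct (correct_reach _ HC) as [n Hn]; eapply subtyping_reach; eauto.
  - clear - HR; intros c c' [X [q [T [S [w [-> [HX [H HC]]]]]]]] Hm; left.
    apply move_inv in Hm as [[X' [q' [w' [-> Ha]]]]|[T' [q' [w' [-> Ha]]]]].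
    + exists X', q', T, S, w'; split; auto.
      split; [exact (act_session _ _ _ _ _ _ HX Ha)|split; auto].
      eapply correct_move; eauto; now apply move_l.
    + inversion Ha as [? bs l ? ? ? ET Hin|? bs l ? ? ? ET Hin]; subst.
      * destruct (subtyping_Sel R T S bs HR H ET)
          as [P [Q [HE [HP [HA [HQ HTQ]]]]]].
        exists X, (q ++ [l]), T', (Q l), w'; do 3 (split; auto).
        apply (correct_antic _ _ _ _ _ _ _ HP HQ HA).
        -- apply in_map_iff; now exists (l, T').
        -- now apply (correct_teq _ _ S).
      * destruct (subtyping_Bra R T S bs HR H ET) as [cs [ES _]].
        destruct (correct_reach _ HC) as [n Hn].
        destruct (correct_receives _ _ _ _ _ _ _ ES Hn) as [S' HinS].
        destruct (subtyping_read R X q' T S l w' bs cs S')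
          as [HC' [T1 [HinT HT1]]]; auto.
        assert (HT := proj1 (proj1 (HR _ _ H))).
        apply wf_unfold in HT; rewrite ET in HT.
        (* Labels are distinct, so the continuation actually taken by [T] is the one related to
           [S']. *)
        rewrite (Bra_branch_eq bs l T' T1); auto.
        exists X, q', T1, S', w'; auto.
Qed.

End Subtyping.

Theorem theorem3p8 (L : Type) (T S : term L) (hT : session T) (hS : session S) :
  fair_async_subtype T S -> refines T S.
Proof.
  intros Hsub X HX HC.
  destruct Hsub as [R [HR H]]; [now exists X|].
  apply correct_composition_iff in HC; [|split; [apply HX|apply hS]].
  apply correct_composition_iff; [split; [apply HX|apply hT]|].
  now apply (subtyping_correct R X [] T S []).
Qed.
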